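(* Let $\Lambda$ be a finite-dimensional absolutely Koszul algebra. If the global linearity defect $\mathrm{gl\,ld}_\Lambda$ of $\Lambda$ is finite, then the graded finitistic dimension $$\mathrm{grfin\,dim}\,\Lambda=\sup\{\mathrm{pd}_{\Lambda\text{-gmod}}M \mid M\in\Lambda\text{-gmod},\ \mathrm{pd}_{\Lambda\text{-gmod}}M<\infty\}$$ of $\Lambda$ is finite.
   Context: $k$ is a field and $\Lambda=kQ/I$ is finite-dimensional, with $Q$ a finite quiver and $I$ generated by linear combinations of paths of length 2; $\Lambda$ is graded by path length. $\Lambda\text{-gmod}$ is the category of finite-dimensional graded left $\Lambda$-modules (covariant functors, arrows acting with degree $1$) with degree-preserving morphisms. For $x\in Q_0$, $P_x=\Lambda(x,-)$ is the indecomposable graded projective module generated in degree $0$ and $S_x$ its simple top. $\Lambda$ is Koszul if every $S_x$ has a linear minimal graded projective resolution, i.e. one all of whose differentials have matrix entries that are linear combinations of arrows. Let $M\in\Lambda\text{-gmod}$ with minimal graded projective resolution $P^\bullet\to M$ (with $P^{-i}$ in cohomological degree $-i$, $i\ge 0$). The entries of each differential between indecomposable summands are linear combinations of paths of a common length $j\ge 1$. The linear part $\mathrm{Lin}^\Lambda(P^\bullet)$ is the complex with the same terms in which only the entries with $j=1$ are kept and all others are replaced by $0$. The linearity defect of $M$ is $\mathrm{ld}_\Lambda(M)=\sup\{i\mid H^{-i}(\mathrm{Lin}^\Lambda(P^\bullet))\ne 0\}$, and the global linearity defect is $\mathrm{gl\,ld}_\Lambda=\sup\{\mathrm{ld}_\Lambda(M)\mid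 M\in\Lambda\text{-gmod}\}$. $M$ is weakly Koszul if $H^{-i}(\mathrm{Lin}^\Lambda(P^\bullet))=0$ for all $i>0$. $\Lambda$ is absolutely Koszul if it is Koszul and every finite-dimensional graded $\Lambda$-module has a weakly Koszul syzygy $\Omega^n(M)$, $n\ge 0$ (equivalently, finite linearity defect). *)

(* Defs.v *)
From HB Require Import structures.
From mathcomp Require Import all_boot all_order all_algebra all_field.
From mathcomp Require Import finmap.
From mathcomp Require Import boolp.
From mathcomp.multinomials Require Import monalg.

Set Implicit Arguments.
Unset Strict Implicit.
Unset Printing Implicit Defensive.

Import Order.TTheory GRing.Theory Num.Theory.

Local Open Scope ring_scope.

Inductive enat := Fin of nat | Infty.

Definition le_enat (a b : enat) : Prop :=
  match a, b with
  | _, Infty => True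
  | Infty, Fin _ => False
  | Fin m, Fin n => (m <= n)%N
  end.

(* The least upper bound; the supremum of the empty set is 0. *)
Definition esup (A : enat -> Prop) : enat :=
  match pselect (exists n, `[< forall a, A a -> le_enat a (Fin n) >]) with
  | left h => Fin (ex_minn h)
  | right _ => Infty
  end.

(* The minimum; the infimum of the empty set is infinite. *)
Definition einf (A : nat -> Prop) : enat :=
  match pselect (exists n, `[< A n >]) with
  | left h => Fin (ex_minn h)
  | right _ => Infty
  end.

Lemma esup_finP (A : enat -> Prop) :
  esup A <> Infty <-> exists n, forall a, A a -> le_enat a (Fin n).
Proof.
rewrite /esup; case: pselect => [h|h]; split=> //.
  by move=> _; have [n /asboolP hn] := h; exists n.
by move=> [n hn]; case: h; exists n; apply/asboolP.
Qed.

Lemma einf_leP (A : nat -> Prop) n :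
  le_enat (einf A) (Fin n) <-> exists2 m, A m & (m <= n)%N.
Proof.
rewrite /einf; case: pselect => [h|h] /=; last first.
  by split=> // -[m Am _]; case: h; exists m; apply/asboolP.
case: ex_minnP => m /asboolP Am min_m; split=> [le_mn|[p Ap le_pn]].
  by exists m.
by apply: leq_trans le_pn; apply: min_m; apply/asboolP.
Qed.

Record quiver := Quiver {
  vert : finType;
  arrow : finType;
  src : arrow -> vert;
  tgt : arrow -> vert
}.

Fixpoint walk (Q : quiver) (x : vert Q) (s : seq (arrow Q)) : bool :=
  if s is a :: s' then (src a == x) && walk (tgt a) s' else true.

Definition walk_end (Q : quiver) (x : vert Q) (s : seq (arrow Q)) : vert Q :=
  foldl (fun _ a => tgt a) x s.

Lemma walk_cat (Q : quiver) (x : vert Q) (s t : seq (arrow Q)) :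
  walk x (s ++ t) = walk x s && walk (walk_end x s) t.
Proof. by elim: s x => //= a s IHs x; rewrite IHs andbA. Qed.

(* A path is its starting vertex together with its arrows, listed in the order
   in which they are traversed; (x, [::]) is the trivial path at x. *)
Record qpath (Q : quiver) := QPath {
  qpath_val :> vert Q * seq (arrow Q);
  qpath_walk : walk qpath_val.1 qpath_val.2
}.

HB.instance Definition _ (Q : quiver) := [isSub for @qpath_val Q].
HB.instance Definition _ (Q : quiver) := [Choice of qpath Q by <:].

Definition path_src (Q : quiver) (p : qpath Q) : vert Q := p.1.
Definition path_tgt (Q : quiver) (p : qpath Q) : vert Q :=
  walk_end p.1 p.2.
Definition path_length (Q : quiver) (p : qpath Q) : nat := size p.2.

Definition trivial_path (Q : quiver) (x : vert Q) : qpath Q :=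
  @QPath Q (x, [::]) isT.

Lemma path_comp_subproof (Q : quiver) (q p : qpath Q) :
  path_tgt p = path_src q -> walk (path_src p) (p.2 ++ q.2).
Proof.
by move=> h; rewrite walk_cat qpath_walk -/(path_tgt p) h; apply: qpath_walk.
Qed.

(* First p, then q. *)
Definition path_comp (Q : quiver) (q p : qpath Q)
    (h : path_tgt p = path_src q) : qpath Q :=
  @QPath Q (path_src p, p.2 ++ q.2) (path_comp_subproof h).

(* The underlying vector space of kQ, with basis << p >>, p a path. *)
Definition path_alg (k : fieldType) (Q : quiver) := {malg k[qpath Q]}.

(* Paths compose like functions, so that left modules over kQ are covariant
   representations of Q. *)
Definition path_mul (k : fieldType) (Q : quiver) (q p : qpath Q) :
    path_alg k Q :=
  if path_tgt p =P path_src q is ReflectT h then << path_comp h >> else 0.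

Definition kQmul (k : fieldType) (Q : quiver) (f g : path_alg k Q) :
    path_alg k Q :=
  \sum_(q <- msupp f) \sum_(p <- msupp g) (f@_q * g@_p) *: path_mul k q p.

Definition kQone (k : fieldType) (Q : quiver) : path_alg k Q :=
  \sum_(x : vert Q) << trivial_path x >>.

(* The two-sided ideal of kQ generated by R; it is stable under scalars because
   kQ is unital. *)
Inductive ideal (k : fieldType) (Q : quiver) (R : path_alg k Q -> Prop) :
    path_alg k Q -> Prop :=
| ideal_gen r of R r : ideal R r
| ideal_zero : ideal R 0
| ideal_add f g of ideal R f & ideal R g : ideal R (f + g)
| ideal_mull f g of ideal R g : ideal R (kQmul f g)
| ideal_mulr f g of ideal R f : ideal R (kQmul f g).

Definition quadratic (k : fieldType) (Q : quiver) (R : path_alg k Q -> Prop) :=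
  forall r, R r -> forall p, p \in msupp r -> path_length p = 2%N.

(* An identification of the finite-dimensional algebra L with kQ/I, where I is
   the ideal generated by R: a surjective algebra map kQ -> L with kernel I. *)
Record presentation (k : fieldType) (Q : quiver) (R : path_alg k Q -> Prop)
    (L : falgType k) := Presentation {
  pres :> {linear path_alg k Q -> L};
  pres_mul : forall f g, pres (kQmul f g) = pres f * pres g;
  pres_one : pres (kQone k Q) = 1;
  pres_surj : forall a, exists f, pres f = a;
  pres_ker : forall f, pres f = 0 <-> ideal R f
}.

Section GradedModules.

Context (k : fieldType) (Q : quiver) (R : path_alg k Q -> Prop).
Context (L : falgType k) (pi : presentation R L).

Definition idem (x : vert Q) : L := pi << trivial_path x >>.

(* a is a linear combination of paths of length z; only a = 0 satisfies this when z < 0. *)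
Definition Ldeg (z : int) (a : L) : Prop :=
  exists2 f : path_alg k Q,
    forall p, p \in msupp f -> (path_length p)%:Z = z & pi f = a.

(* The radical of L. *)
Definition Lrad (a : L) : Prop :=
  exists2 f : path_alg k Q,
    forall p, p \in msupp f -> (0 < path_length p)%N & pi f = a.

(* The k-structure of a left L-module is given by c |-> c%:A. *)
Record gmod := GMod {
  gcar :> lmodType L;
  gdeg : int -> gcar -> Prop;
  gdeg0 : forall d, gdeg d 0;
  gdegB : forall d m m', gdeg d m -> gdeg d m' -> gdeg d (m - m');
  gdegZ : forall z d a m, Ldeg z a -> gdeg d m -> gdeg (z + d) (a *: m);
  gdeg_span : forall m, exists (s : seq int) (c : int -> gcar),
    [/\ uniq s, forall d, gdeg d (c d) & m = \sum_(d <- s) c d];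
  gdeg_direct : forall (s : seq int) (c : int -> gcar),
    uniq s -> (forall d, gdeg d (c d)) -> \sum_(d <- s) c d = 0 ->
    forall d, d \in s -> c d = 0;
  gfindim : exists (n : nat) (b : 'I_n -> gcar),
    forall m, exists c : 'I_n -> k, m = \sum_(i < n) (c i)%:A *: b i
}.

Definition gmorphism (M N : gmod) (f : M -> N) : Prop :=
  forall d m, gdeg d m -> gdeg d (f m).

Definition surjective_map (A B : Type) (f : A -> B) : Prop :=
  forall b, exists a, f a = b.

Definition projective (P : gmod) : Prop :=
  forall (M N : gmod) (g : {linear M -> N}) (f : {linear P -> N}),
    gmorphism g -> gmorphism f -> surjective_map g ->
    exists h : {linear P -> M}, gmorphism h /\ forall p, g (h p) = f p.

Definition has_proj_res (M : gmod) (n : nat) : Prop :=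
  exists (P : nat -> gmod) (d : forall i, {linear P i.+1 -> P i})
         (eps : {linear P 0%N -> M}),
    [/\ forall i, projective (P i),
        gmorphism eps /\ (forall i, gmorphism (d i)),
        surjective_map eps,
        (forall v, eps v = 0 <-> exists w, d 0%N w = v) /\
        (forall i v, d i v = 0 <-> exists w, d i.+1 w = v)
      & forall i, (n < i)%N -> forall v : P i, v = 0].

Definition pd (M : gmod) : enat := einf (has_proj_res M).

Definition grfin_dim : enat :=
  esup (fun a => exists M : gmod, pd M <> Infty /\ a = pd M).

(* The graded projective module which is the direct sum of the P_x generated in
   degree d, for x = gvtx j, d = ggen j and j < grk.  As P_x = L e_x, it is the
   submodule [in_gproj] of row vectors of length grk over L. *)
Record gproj := GProj {
  grk : nat;
  gvtx : 'I_grk -> vert Q;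
  ggen : 'I_grk -> int
}.

Definition in_gproj (P : gproj) (v : 'rV[L]_(grk P)) : Prop :=
  forall j, v 0 j * idem (gvtx j) = v 0 j.

Definition gproj_deg (P : gproj) (d : int) (v : 'rV[L]_(grk P)) : Prop :=
  in_gproj v /\ forall j, Ldeg (d - ggen j) (v 0 j).

(* Graded maps P -> P' are right multiplications by matrices, whose entry from
   P_y generated in degree d to P_x generated in degree d' belongs to
   L(x, y) = e_y L e_x and has degree d - d'. *)
Definition gproj_map (P P' : gproj) (A : 'M[L]_(grk P, grk P')) : Prop :=
  forall j l,
    idem (gvtx j) * A j l * idem (gvtx l) = A j l /\
    Ldeg (ggen j - ggen l) (A j l).

(* Graded maps P -> M are given by the images of the generators of P. *)
Definition gproj_eval (P : gproj) (M : gmod) (eps : 'I_(grk P) -> M)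
    (v : 'rV[L]_(grk P)) : M :=
  \sum_(j < grk P) v 0 j *: eps j.

Definition gproj_gens (P : gproj) (M : gmod) (eps : 'I_(grk P) -> M) : Prop :=
  forall j, idem (gvtx j) *: eps j = eps j /\ gdeg (ggen j) (eps j).

Definition gproj_onto (P : gproj) (M : gmod) (eps : 'I_(grk P) -> M) : Prop :=
  forall m, exists2 v, in_gproj v & gproj_eval eps v = m.

(* The term [gterm i] and the differential [gdiff i] sit in cohomological
   degrees -i and -(i+1). *)
Record gseq := GSeq {
  gterm : nat -> gproj;
  gdiff : forall i, 'M[L]_(grk (gterm i.+1), grk (gterm i));
  gdiff_map : forall i, gproj_map (gdiff i)
}.

Definition resolves (C : gseq) (M : gmod) : Prop :=
  exists eps : 'I_(grk (gterm C 0)) -> M,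
    [/\ gproj_gens eps, gproj_onto eps,
        forall v, in_gproj v ->
          (gproj_eval eps v = 0 <->
           exists2 w, in_gproj w & w *m gdiff C 0 = v)
      & forall i (v : 'rV[L]_(grk (gterm C i.+1))), in_gproj v ->
          (v *m gdiff C i = 0 <->
           exists2 w, in_gproj w & w *m gdiff C i.+1 = v)].

Definition min_resolution (C : gseq) (M : gmod) : Prop :=
  resolves C M /\ forall i j l, Lrad (gdiff C i j l).

Definition linear_entries (C : gseq) : Prop :=
  forall i j l, Ldeg 1 (gdiff C i j l).

(* The entry at (j, l) is a combination of paths of length ggen j - ggen l. *)
Definition lin_diff (C : gseq) (i : nat) :
    'M[L]_(grk (gterm C i.+1), grk (gterm C i)) :=
  \matrix_(j, l) if ggen j - ggen l == 1 then gdiff C i j l else 0.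

Lemma lin_diff_map (C : gseq) i : gproj_map (lin_diff C i).
Proof.
move=> j l; rewrite mxE; case: ifP => _; first exact: gdiff_map.
rewrite mulr0 mul0r; split=> //; exists 0; last by rewrite linear0.
by move=> p; rewrite msupp0 in_fset0.
Qed.

Definition linear_part (C : gseq) : gseq := GSeq (@lin_diff_map C).

Definition cocycle (C : gseq) (i : nat) : 'rV[L]_(grk (gterm C i)) -> Prop :=
  match i with
  | 0%N => fun v => in_gproj v
  | i'.+1 => fun v => in_gproj v /\ v *m gdiff C i' = 0
  end.

Definition coboundary (C : gseq) (i : nat) (v : 'rV[L]_(grk (gterm C i))) :=
  exists2 w, in_gproj w & w *m gdiff C i = v.

(* H^{-i}(C) <> 0, for C a complex; the linear part of a minimal resolution is
   one. *)
Definition nonzero_homology (C : gseq) (i : nat) : Prop :=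
  exists v, @cocycle C i v /\ ~ coboundary v.

(* H^{-i}(Lin(P)) <> 0, where P is the minimal resolution of M, which is unique
   up to isomorphism. *)
Definition nonzero_lin_homology (M : gmod) (i : nat) : Prop :=
  exists C, min_resolution C M /\ nonzero_homology (linear_part C) i.

Definition ld (M : gmod) : enat :=
  esup (fun a => exists i, nonzero_lin_homology M i /\ a = Fin i).

Definition gl_ld : enat := esup (fun a => exists M : gmod, a = ld M).

Definition weakly_koszul (M : gmod) : Prop :=
  forall i, (0 < i)%N -> ~ nonzero_lin_homology M i.

(* M is isomorphic to S_x: one-dimensional, at the vertex x and in degree 0. *)
Definition simple_at (x : vert Q) (M : gmod) : Prop :=
  exists s : M,
    [/\ s <> 0, gdeg 0 s, idem x *: s = s
      & forall m, exists c : k, m = c%:A *: s].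

Definition koszul : Prop :=
  forall (x : vert Q) (M : gmod), simple_at x M ->
    exists C, min_resolution C M /\ linear_entries C.

(* N is isomorphic to the kernel of a projective cover of M. *)
Definition first_syzygy (M N : gmod) : Prop :=
  exists (P : gproj) (eps : 'I_(grk P) -> M) (f : {linear N -> 'rV[L]_(grk P)}),
    [/\ gproj_gens eps /\ gproj_onto eps,
        forall v, in_gproj v -> gproj_eval eps v = 0 -> forall j, Lrad (v 0 j),
        injective f,
        forall d n, gdeg d n -> gproj_deg d (f n)
      & forall v, (in_gproj v /\ gproj_eval eps v = 0) <-> exists n, f n = v].

Fixpoint syzygy (n : nat) (M N : gmod) : Prop :=
  if n is n'.+1 then exists K, first_syzygy M K /\ syzygy n' K N else N = M.

Definition absolutely_koszul : Prop :=
  koszul /\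
  forall M : gmod, exists (n : nat) (N : gmod), syzygy n M N /\ weakly_koszul N.

End GradedModules.

(* Main.v *)
Require Import Defs.
From HB Require Import structures.
From mathcomp Require Import all_boot all_order all_algebra all_field.
From mathcomp Require Import finmap.
From mathcomp Require Import boolp.
From mathcomp.multinomials Require Import monalg.
From mathcomp Require Import zify ring.

Set Implicit Arguments.
Unset Strict Implicit.
Unset Printing Implicit Defensive.

Import Order.TTheory GRing.Theory Num.Theory.

Local Open Scope ring_scope.

(** The linearity defect controls the length of a finite minimal resolution,
through the Hilbert series of the strands of its linear part.

Let C be the minimal resolution of a module M of finite projective dimension,
and c = gl ld.  The differentials of Lin(C) have degree 1 entries, so Lin(C)
is the direct sum of its strands: the j-th strand consists of the summands of
C^(-i) generated in degree i + j.  Let q_i(y) be the number of those summands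
isomorphic to a shift of P_y, and let c_m(x, y) = dim e_x L_m e_y.  In internal
degree j + D and at the vertex x, the strand is a complex of vector spaces with
terms of dimension sum_y c_(D-i)(x, y) q_i(y).  If L_m = 0 for m > l and
D > c + l, the terms with i <= c are zero, while the homology vanishes for
i > c; the complex is exact, its Euler characteristic is zero, and
  sum_i (-1)^i sum_y c_(D-i)(x, y) q_i(y) = 0      ([strand_euler]).
In other words, if H(t) is the matrix of the polynomials sum_m c_m(x, y) t^m,
and q(t) the vector of the polynomials sum_i (-1)^i q_i(y) t^i, then H(t) q(t)
has degree at most c + l.  As H(0) is the identity matrix, det H is nonzero, and
det H * q = adj H * (H q) bounds the degree of q in terms of L and c
([bounded_solutions]).  Within one strand the sign (-1)^i is attached to t^i, so
nothing cancels in q, and C^(-i) = 0 as soon as i exceeds the bound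
([length_bound]).

Finiteness of C is used to know that q is a polynomial rather than a power
series.  It must be derived from the existence of some finite projective
resolution P of M ([min_resolution_length]).  The comparison theorem gives chain
maps f : C -> P and g : P -> C over M; by minimality 1 - g f is nilpotent in each
degree, and it is the identity wherever P vanishes.

The rest of the file provides what this needs: the path length grading of L, the
fact that the projectives P_x are projective graded modules, and the existence
of minimal resolutions. *)

(** * Homogeneous parts in the path algebra *)

Section PathGrading.

Context (k : fieldType) (Q : quiver).

Definition hpart_sum_def (z : int) (f : path_alg k Q) : path_alg k Q :=
  \sum_(p <- msupp f | (path_length p)%:Z == z) << f@_p *g p >>.

(** Locked, since unification otherwise unfolds it when it meets other elements of
the path algebra. *)
Definition hpart := locked hpart_sum_def.

Lemma hpartE z f p :
  (hpart z f)@_p = if (path_length p)%:Z == z then f@_p else 0.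
Proof.
rewrite /hpart -lock /hpart_sum_def big_mkcond raddf_sum /=.
case: (msuppP f p) => [pf|pf]; last first.
  rewrite if_same big_seq big1 // => q qf; case: ifP => _; rewrite ?mcoeff0 //.
  rewrite mcoeffU; case: eqP => [qp|]; last by rewrite mulr0n.
  by rewrite qp (negPf pf) in qf.
rewrite (big_fsetD1 p) //= big_seq big1 ?addr0.
  by case: ifP => _; rewrite ?mcoeff0 // mcoeffU eqxx.
move=> q; rewrite !inE => /andP[/negPf qp _].
by case: ifP => _; rewrite ?mcoeff0 // mcoeffU qp mulr0n.
Qed.

Lemma hpart_is_linear z : linear (hpart z).
Proof.
move=> c f g; apply/malgP => p.
rewrite hpartE [RHS]mcoeffD [X in _ = X + _]mcoeffZ !hpartE.
case: ifP => _; first by rewrite mcoeffD mcoeffZ.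
by rewrite mulr0 addr0.
Qed.

HB.instance Definition _ z :=
  GRing.isLinear.Build k (path_alg k Q) (path_alg k Q) *:%R (hpart z)
    (hpart_is_linear z).

Definition homog (z : int) (f : path_alg k Q) :=
  forall p, p \in msupp f -> (path_length p)%:Z = z.

Lemma hpart_homog z f : homog z (hpart z f).
Proof.
move=> p; rewrite -mcoeff_neq0 hpartE; by case: ifP => [/eqP ->|]; rewrite ?eqxx.
Qed.

Lemma hpart_homogE z w f : homog w f -> hpart z f = if z == w then f else 0.
Proof.
move=> hf; apply/malgP => p; rewrite hpartE.
case: (msuppP f p) => [pf|pf].
  rewrite (hf p pf) eq_sym; case: ifP => _; by rewrite ?mcoeff0.
by rewrite if_same; case: ifP => _; rewrite ?mcoeff0 // mcoeff_outdom.
Qed.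

Definition max_len (f : path_alg k Q) : nat :=
  (\max_(p <- msupp f) path_length p).+1.

Lemma hpart_sum f : f = \sum_(m < max_len f) hpart m%:Z f.
Proof.
apply/malgP => p; rewrite raddf_sum /=.
under eq_bigr => i _ do rewrite hpartE eqz_nat.
case: (msuppP f p) => [pf|pf]; last by rewrite big1 // => i _; rewrite if_same.
have lt : (path_length p < max_len f)%N by rewrite ltnS (leq_bigmax_seq (F := @path_length Q)).
rewrite (bigD1 (Ordinal lt)) //= eqxx big1 ?addr0 // => i ip.
by rewrite ifN // eq_sym.
Qed.

Lemma kQmulEw (A B : {fset qpath Q}) (f g : path_alg k Q) :
  (msupp f `<=` A)%fset -> (msupp g `<=` B)%fset ->
  kQmul f g = \sum_(q <- A) \sum_(p <- B) (f@_q * g@_p) *: path_mul k q p.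
Proof.
move=> sA sB; rewrite /kQmul (big_fset_incl _ sA) /=; last first.
  move=> q _ qf; rewrite big1 // => p _.
  by rewrite (mcoeff_outdom qf) mul0r scale0r.
apply: eq_bigr => q _; rewrite (big_fset_incl _ sB) // => p _ pg.
by rewrite (mcoeff_outdom pg) mulr0 scale0r.
Qed.

Lemma path_mul_homog q p :
  homog ((path_length q)%:Z + (path_length p)%:Z) (path_mul k q p).
Proof.
rewrite /path_mul; case: eqP => [h|_] r; last by rewrite msupp0 in_fset0.
move/(fsubsetP msuppU_le); rewrite in_fset1 => /eqP ->.
by rewrite /path_length /= size_cat PoszD addrC.
Qed.

Lemma homogD z f g : homog z f -> homog z g -> homog z (f + g).
Proof.
move=> hf hg p /(fsubsetP (msuppD_le _ _)).
by rewrite in_fsetU => /orP[/hf|/hg].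
Qed.

Lemma homogZ z c f : homog z f -> homog z (c *: f).
Proof. by move=> hf p /(fsubsetP (msuppZ_le _ _)) /hf. Qed.

Lemma homog0 z : homog z 0.
Proof. by move=> p; rewrite msupp0 in_fset0. Qed.

Lemma homog_kQmul z w f g : homog z f -> homog w g -> homog (z + w) (kQmul f g).
Proof.
move=> hf hg; rewrite /kQmul; rewrite big_seq.
apply: (big_ind (homog (z + w))) => [||q qf]; [exact: homog0|exact: homogD|].
rewrite big_seq; apply: (big_ind (homog (z + w))) => [||p pg]; [exact: homog0|exact: homogD|].
by rewrite -(hf q qf) -(hg p pg); apply/homogZ/path_mul_homog.
Qed.

Lemma homogU p c : homog (path_length p)%:Z << c *g p >>.
Proof. by move=> q /(fsubsetP msuppU_le); rewrite in_fset1 => /eqP ->. Qed.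

(** Only one of the two factors is cut into homogeneous parts: this is the form in
which an ideal is seen to contain the parts of a product. *)
Lemma hpart_kQmul z f g :
  hpart z (kQmul f g) =
  \sum_(q <- msupp f)
     kQmul << f@_q *g q >> (hpart (z - (path_length q)%:Z) g).
Proof.
rewrite raddf_sum /=; apply: eq_bigr => q _.
rewrite (@kQmulEw [fset q]%fset (msupp g)) ?msuppU_le //; last first.
  apply/fsubsetP => p; rewrite -!mcoeff_neq0 hpartE.
  by case: ifP; rewrite ?eqxx.
rewrite big_seq_fset1 raddf_sum /=; apply: eq_bigr => p _.
rewrite linearZ /= mcoeffU eqxx mulr1n hpartE.
rewrite (hpart_homogE z (@path_mul_homog q p)).
rewrite -subr_eq0 opprD addrA subr_eq0 [_ == (path_length p)%:Z]eq_sym.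
by case: ifP => _; rewrite ?mulr0 ?scaler0 ?scale0r.
Qed.

Lemma hpart_kQmulr z f g :
  hpart z (kQmul f g) =
  \sum_(p <- msupp g)
     kQmul (hpart (z - (path_length p)%:Z) f) << g@_p *g p >>.
Proof.
rewrite /kQmul exchange_big raddf_sum /=; apply: eq_bigr => p _.
rewrite -/(kQmul _ _) (@kQmulEw (msupp f) [fset p]%fset) ?msuppU_le //; last first.
  apply/fsubsetP => q; rewrite -!mcoeff_neq0 hpartE.
  by case: ifP; rewrite ?eqxx.
rewrite raddf_sum /=; apply: eq_bigr => q _.
rewrite big_seq_fset1 linearZ /= mcoeffU eqxx mulr1n hpartE.
rewrite (hpart_homogE z (@path_mul_homog q p)).
rewrite addrC -subr_eq0 opprD addrA subr_eq0 [_ == (path_length q)%:Z]eq_sym.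
by case: ifP => _; rewrite ?mul0r ?scaler0 ?scale0r.
Qed.

Context (R : path_alg k Q -> Prop) (quadR : quadratic R).

Lemma ideal_sum (I : eqType) (s : seq I) (F : I -> path_alg k Q) :
  (forall i, i \in s -> ideal R (F i)) -> ideal R (\sum_(i <- s) F i).
Proof.
move=> h; rewrite big_seq; apply: big_ind => //; first exact: ideal_zero.
exact: ideal_add.
Qed.

(** An ideal generated by homogeneous elements is homogeneous; this is what makes L
graded. *)
Lemma ideal_hpart z f : ideal R f -> ideal R (hpart z f).
Proof.
move=> If; elim: If z => [r Rr||g h _ IHg _ IHh|g h _ IHh|g h _ IHg] z.
- rewrite (@hpart_homogE z 2) => [|p /(quadR Rr) -> //].
  by case: ifP => _; [exact: ideal_gen|exact: ideal_zero].
- rewrite linear0; exact: ideal_zero.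
- by rewrite linearD; apply: ideal_add; [exact: IHg|exact: IHh].
- by rewrite hpart_kQmul; apply: ideal_sum => q _; apply: ideal_mull.
- by rewrite hpart_kQmulr; apply: ideal_sum => q _; apply: ideal_mulr.
Qed.

(** Relations of degree 2 generate no element with a term of length 0 or 1, so the
vertices stay nonzero in L. *)
Lemma ideal_low f p : ideal R f -> (path_length p < 2)%N -> f@_p = 0.
Proof.
move=> If; elim: If p => [r Rr||g h _ IHg _ IHh|g h _ IHh|g h _ IHg] p lp.
- by case: (msuppP r p) => // /(quadR Rr) e; rewrite e in lp.
- by rewrite mcoeff0.
- by rewrite mcoeffD IHg // IHh // addr0.
- rewrite /kQmul raddf_sum big1 // => q _ /=; rewrite raddf_sum big1 // => p' _ /=.
  rewrite mcoeffZ; case: (msuppP (path_mul k q p') p) => [|_]; last by rewrite mulr0.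
  move/path_mul_homog => e; rewrite IHh ?mulr0 ?mul0r //; lia.
- rewrite /kQmul raddf_sum big1 // => q _ /=; rewrite raddf_sum big1 // => p' _ /=.
  rewrite mcoeffZ; case: (msuppP (path_mul k q p') p) => [|_]; last by rewrite mulr0.
  move/path_mul_homog => e; rewrite IHg ?mulr0 ?mul0r //; lia.
Qed.

End PathGrading.

(** * The grading of L *)

Section AlgebraGrading.

Context (k : fieldType) (Q : quiver) (R : path_alg k Q -> Prop).
Context (quadR : quadratic R) (L : falgType k) (pi : presentation R L).

Lemma pres_hpart0 z f : pi f = 0 -> pi (hpart z f) = 0.
Proof. by move/pres_ker => If; apply/pres_ker/ideal_hpart. Qed.

(** A k-linear section of the presentation, so that the homogeneous components
below are linear by construction. *)
Definition pres_lift (a : L) : path_alg k Q :=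
  \sum_(i < \dim {:L})
     coord (vbasis {:L}) i a *: sval (cid (pres_surj pi (vbasis {:L})`_i)).

Lemma pres_lift_is_linear : linear pres_lift.
Proof.
move=> c a b; rewrite /pres_lift scaler_sumr -big_split /=; apply: eq_bigr => i _.
by rewrite linearP /= scalerDl scalerA.
Qed.

HB.instance Definition _ :=
  GRing.isLinear.Build k L (path_alg k Q) *:%R pres_lift pres_lift_is_linear.

Lemma pres_liftK a : pi (pres_lift a) = a.
Proof.
rewrite [RHS](coord_vbasis (memvf a)) linear_sum; apply: eq_bigr => i _.
by rewrite linearZ /=; congr (_ *: _); case: cid.
Qed.

Definition Lcomp (z : int) (a : L) : L := pi (hpart z (pres_lift a)).

Lemma LcompE z f : Lcomp z (pi f) = pi (hpart z f).
Proof.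
apply/eqP; rewrite -subr_eq0 /Lcomp -!linearB /=.
by apply/eqP/pres_hpart0; rewrite linearB /= pres_liftK subrr.
Qed.

Lemma Lcomp_is_linear z : linear (Lcomp z).
Proof.
by move=> c a b; rewrite /Lcomp !linearP.
Qed.

HB.instance Definition _ z :=
  GRing.isLinear.Build k L L *:%R (Lcomp z) (Lcomp_is_linear z).

Lemma Ldeg_comp z a : Ldeg pi z (Lcomp z a).
Proof. by exists (hpart z (pres_lift a)) => //; apply: hpart_homog. Qed.

Lemma Lcomp_deg z w a : Ldeg pi w a -> Lcomp z a = if z == w then a else 0.
Proof.
case=> f hf <-; rewrite LcompE (@hpart_homogE _ _ z w) //.
by case: ifP => _; rewrite ?linear0.
Qed.

Lemma LdegP z a : Ldeg pi z a <-> Lcomp z a = a.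
Proof.
by split=> [/Lcomp_deg->|<-]; [rewrite eqxx|apply: Ldeg_comp].
Qed.

Lemma Lcomp_neg z a : z < 0 -> Lcomp z a = 0.
Proof.
move=> z0; rewrite /Lcomp (_ : hpart z _ = 0) ?linear0 //.
apply/malgP => p; rewrite hpartE mcoeff0 ifN //.
by apply/eqP => e; rewrite -e in z0.
Qed.

Lemma LdegB z a b : Ldeg pi z a -> Ldeg pi z b -> Ldeg pi z (a - b).
Proof. by rewrite !LdegP linearB => /= -> ->. Qed.

Lemma Ldeg0 z : Ldeg pi z 0.
Proof. by rewrite LdegP linear0. Qed.

Lemma LdegM z w a b : Ldeg pi z a -> Ldeg pi w b -> Ldeg pi (z + w) (a * b).
Proof.
case=> f hf <- [g hg <-]; exists (kQmul f g); last exact: pres_mul.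
exact: homog_kQmul.
Qed.

Lemma Lcomp_sum_comp z n a :
  Lcomp z (\sum_(m < n) Lcomp m%:Z a) =
    if (0 <= z) && (z < n%:Z) then Lcomp z a else 0.
Proof.
rewrite linear_sum /=; case: ifP => [/andP[z0 zn]|zn]; last first.
  rewrite big1 // => m _; rewrite (Lcomp_deg z (Ldeg_comp _ _)) ifN //.
  by apply: contraFN zn => /eqP ->; rewrite ltz_nat ltn_ord.
case: z z0 zn => // z _ zn.
rewrite (bigD1 (Ordinal (zn : (z < n)%N))) //= big1 ?addr0 => [|m mz].
  by rewrite (Lcomp_deg _ (Ldeg_comp _ _)) eqxx.
by rewrite (Lcomp_deg _ (Ldeg_comp _ _)) ifN // eq_sym.
Qed.

Lemma Lcomp_fin a : exists N : nat, a = \sum_(m < N) Lcomp m%:Z a.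
Proof.
exists (max_len (pres_lift a)).
by rewrite -{1}[a]pres_liftK {1}[pres_lift a]hpart_sum linear_sum.
Qed.

Lemma Lcomp_eq0 a : (forall z, Lcomp z a = 0) -> a = 0.
Proof. by move=> h; have [N ->] := Lcomp_fin a; rewrite big1. Qed.

(** L is finite-dimensional: finitely many components of finitely many basis vectors
span it. *)
Lemma Lcomp_bounded : exists l : nat, forall z a, l%:Z < z -> Lcomp z a = 0.
Proof.
pose b := vbasis {:L}.
pose N (i : 'I_(\dim {:L})) := sval (cid (Lcomp_fin b`_i)).
have NE (i : 'I_(\dim {:L})) : b`_i = \sum_(m < N i) Lcomp m%:Z b`_i.
  by rewrite /N; case: cid.
exists (\max_i N i) => z a lz.
rewrite (coord_vbasis (memvf a)) linear_sum big1 // => i _ /=.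
rewrite linearZ /= -/b NE Lcomp_sum_comp ifN ?scaler0 //.
have : (N i <= \max_i N i)%N by exact: leq_bigmax.
lia.
Qed.

Lemma pres_msuppE g : \sum_(p <- msupp g) pi << g@_p *g p >> = pi g.
Proof. by rewrite [in RHS](monalgE g) linear_sum. Qed.

Lemma Lcomp_mulr z w a b : Ldeg pi w b -> Lcomp z (a * b) = Lcomp (z - w) a * b.
Proof.
case=> g hg <-; rewrite -[a]pres_liftK -pres_mul !LcompE hpart_kQmulr.
rewrite linear_sum -[pi g]pres_msuppE mulr_sumr /=.
by rewrite [LHS]big_seq [RHS]big_seq; apply: eq_bigr => p /hg ->; rewrite pres_mul.
Qed.

Lemma Ldeg_idem x : Ldeg pi 0 (idem pi x).
Proof. by exists << trivial_path x >> => //; exact: (@homogU k Q (trivial_path x) 1). Qed.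

Lemma idemM x y : idem pi x * idem pi y = if x == y then idem pi x else 0.
Proof.
rewrite /idem -pres_mul.
rewrite (@kQmulEw _ _ [fset trivial_path x]%fset [fset trivial_path y]%fset);
  try exact: msuppU_le.
rewrite !big_seq_fset1 !mcoeffU !eqxx mulr1 scale1r /path_mul.
case: (path_tgt (trivial_path y) =P path_src (trivial_path x)) => [e|ne].
  have e' : y = x by [].
  rewrite [x == y]eq_sym {2}e' eqxx; congr (pi << _ >>); apply: val_inj.
  by rewrite /= /path_src /= e'.
by rewrite linear0; case: eqP => // e; case: ne; rewrite e.
Qed.

Lemma idem_sum : \sum_x idem pi x = 1.
Proof. by rewrite -(pres_one pi) /kQone linear_sum. Qed.

Lemma idem_neq0 x : idem pi x != 0.
Proof.
apply/eqP => /pres_ker /(ideal_low quadR) h.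
have /eqP := h (trivial_path x) isT.
by rewrite mcoeffU eqxx oner_eq0.
Qed.

(** The paths of length 0 are the trivial ones. *)
Lemma Ldeg0_span a : Ldeg pi 0 a -> exists c : vert Q -> k,
  a = \sum_x c x *: idem pi x.
Proof.
case=> f hf <-; exists (fun x => f@_(trivial_path x)).
have E : f = \sum_x f@_(trivial_path x) *: << trivial_path x >>.
  apply/malgP => p; rewrite raddf_sum /=.
  under eq_bigr => x _ do rewrite mcoeffZ mcoeffU.
  case: (msuppP f p) => [pf|pf]; last first.
    rewrite big1 // => x _; case: eqP => [e|_]; last by rewrite mulr0n mulr0.
    by rewrite e mcoeff_outdom // mul0r.
  have ep : p = trivial_path (path_src p).
    apply: val_inj; move: (hf p pf); rewrite /path_length /path_src /=.
    by case: (val p) => x [].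
  rewrite (bigD1 (path_src p)) //= -ep eqxx mulr1 big1 ?addr0 // => x xp.
  rewrite ep; case: eqP => [e|_]; last by rewrite mulr0n mulr0.
  by move: xp; have := congr1 (@path_src Q) e; rewrite /path_src /= => ->; rewrite eqxx.
rewrite {1}E linear_sum; apply: eq_bigr => x _; exact: linearZ.
Qed.

Lemma LradP a : Lrad pi a <-> Lcomp 0 a = 0.
Proof.
split=> [[f hf <-]|a0].
  rewrite LcompE (_ : hpart 0 f = 0) ?linear0 //; apply/malgP => p.
  rewrite hpartE mcoeff0; case: ifP => // /eqP p0.
  by case: (msuppP f p) => // /hf; rewrite -ltz_nat p0.
exists (pres_lift a - hpart 0 (pres_lift a)); last first.
  by rewrite linearB /= pres_liftK -/(Lcomp 0 a) a0 subr0.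
move=> p; rewrite -mcoeff_neq0 mcoeffB hpartE eqz_nat.
by case: (path_length p) => // /eqP; rewrite subrr.
Qed.

(** The filtration of L by degree, whose n-th term is the n-th power of the
radical. *)
Definition Lge (n : nat) (a : L) := forall z : int, z < n%:Z -> Lcomp z a = 0.

Lemma Lge1P a : Lge 1 a <-> Lrad pi a.
Proof.
split=> [h|/LradP h z z1]; first by apply/LradP/h.
by case: (ltrP z 0) => z0; [rewrite Lcomp_neg|rewrite (_ : z = 0) //; lia].
Qed.

Lemma Lge0 a : Lge 0 a.
Proof. by move=> z z0; rewrite Lcomp_neg. Qed.

Lemma Lge_zero n : Lge n 0.
Proof. by move=> z _; rewrite linear0. Qed.

Lemma LgeD n a b : Lge n a -> Lge n b -> Lge n (a + b).
Proof. by move=> ha hb z zn; rewrite linearD /= ha ?hb ?addr0. Qed.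

Lemma Lge_sum n (I : Type) (s : seq I) (F : I -> L) :
  (forall i, Lge n (F i)) -> Lge n (\sum_(i <- s) F i).
Proof.
move=> h; apply: (big_ind (Lge n)) => [|a b|i _].
- exact: (@Lge_zero n).
- exact: (@LgeD n a b).
- exact: h.
Qed.

Lemma LgeM n m a b : Lge n a -> Lge m b -> Lge (n + m) (a * b).
Proof.
move=> ha hb z zn; have [N ->] := Lcomp_fin b.
rewrite mulr_sumr linear_sum big1 // => i _ /=.
rewrite (Lcomp_mulr _ _ (Ldeg_comp _ _)).
case: (ltnP i m) => im; first by rewrite hb ?mulr0 ?ltz_nat.
by rewrite ha ?mul0r //; lia.
Qed.

Lemma Lge_nilp : exists l, forall a, Lge l a -> a = 0.
Proof.
have [l hl] := Lcomp_bounded; exists l.+1 => a ha; apply: Lcomp_eq0 => z.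
by case: (ltrP l%:Z z) => lz; [apply: hl|apply: ha; lia].
Qed.

End AlgebraGrading.

(** * Free graded modules and kernels *)

(** A subspace contained in S but different from it can be enlarged by a line inside
S, and this stops for reasons of dimension. *)
Lemma subspace_vspace (k : fieldType) (V : vectType k) (S : V -> Prop) :
  S 0 -> (forall a u v, S u -> S v -> S (a *: u + v)) ->
  exists U : {vspace V}, forall v, (v \in U) <-> S v.
Proof.
move=> S0 SP.
have [h|h] := pselect (exists U : {vspace V}, forall v, (v \in U) <-> S v) => //.
suff : exists2 U : {vspace V}, (forall v, v \in U -> S v) & (\dim {:V} < \dim U)%N.
  by case=> U _; rewrite ltnNge dimvS ?subvf.
elim: (\dim {:V}).+1 => [|n [U SU dU]].
  by exists 0%VS => // v; rewrite memv0 => /eqP ->.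
have [v Sv vU] : exists2 v, S v & v \notin U.
  apply: contrapT => h'; apply: h; exists U => v; split; first exact: SU.
  by move=> Sv; apply: contrapT => /negP vU; apply: h'; exists v.
exists (<[v]> + U)%VS => [w /memv_addP[_ /vlineP[c ->] [u uU ->]]|].
  by apply: SP => //; apply: SU.
rewrite dimv_disjoint_sum; last first.
  apply/eqP; rewrite -subv0; apply/subvP => w; rewrite memv_cap memv0.
  case/andP=> /vlineP[c ->]; have [->|c0] := eqVneq c 0; first by rewrite scale0r.
  by move=> /(memvZ c^-1); rewrite scalerA mulVf // scale1r (negPf vU).
rewrite dim_vline; case: eqP => [v0|_]; last by rewrite add1n ltnS.
by rewrite v0 mem0v in vU.
Qed.

Section Linear.

Context (A : nzRingType).

(** A name for f that carries its linearity, so that a function proved linear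
becomes an element of the type of linear maps. *)
Definition lin_of (U V : lmodType A) (f : U -> V) (_ : linear f) : U -> V := f.

HB.instance Definition _ (U V : lmodType A) (f : U -> V) (lf : linear f) :=
  GRing.isLinear.Build A U V *:%R (lin_of lf) lf.

Context (M N : lmodType A) (f : {linear M -> N}).

Definition ker_pred : {pred M} := fun m => f m == 0.

Lemma ker_pred_closed : submod_closed ker_pred.
Proof.
split=> [|c u v]; rewrite !unfold_in /ker_pred ?linear0 // => /eqP u0 /eqP v0.
by rewrite linearP /= u0 v0 scaler0 addr0.
Qed.

HB.instance Definition _ :=
  GRing.isSubmodClosed.Build A M ker_pred ker_pred_closed.

Record ker_car := KerCar { ker_val : M; ker_valP : ker_val \in ker_pred }.

HB.instance Definition _ := [isSub for ker_val].
HB.instance Definition _ := [Choice of ker_car by <:].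
HB.instance Definition _ := [SubChoice_isSubLmodule of ker_car by <:].

Lemma ker_val_eq0 (x : ker_car) : f (val x) = 0.
Proof. exact: (eqP (ker_valP x)). Qed.

End Linear.

Section GradedModuleTheory.

Context (k : fieldType) (Q : quiver) (R : path_alg k Q -> Prop).
Context (quadR : quadratic R) (L : falgType k) (pi : presentation R L).

Local Notation gmod := (gmod pi).
Local Notation gproj := (gproj Q).
Local Notation e := (idem pi).
Local Notation Lcomp := (Lcomp pi).

Lemma gdegN (M : gmod) d (m : M) : gdeg d m -> gdeg d (- m).
Proof. by move=> hm; rewrite -sub0r; apply: gdegB => //; apply: gdeg0. Qed.

Lemma gdegD (M : gmod) d (m m' : M) : gdeg d m -> gdeg d m' -> gdeg d (m + m').
Proof. by move=> hm hm'; rewrite -[m']opprK; apply/gdegB/gdegN. Qed.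

Lemma gdeg_sum (M : gmod) d (I : Type) (s : seq I) (F : I -> M) :
  (forall i, gdeg d (F i)) -> gdeg d (\sum_(i <- s) F i).
Proof. by move=> h; apply: big_ind => //; [apply: gdeg0|apply: gdegD]. Qed.

Lemma gdeg_idem (M : gmod) d x (m : M) : gdeg d m -> gdeg d (e x *: m).
Proof. by move=> hm; rewrite -[d]add0r; apply: gdegZ => //; apply: Ldeg_idem. Qed.

(** Uniqueness of the decomposition into homogeneous components, when the sum itself
is homogeneous. *)
Lemma gdeg_part (M : gmod) (s : seq int) (c : int -> M) d m :
  uniq s -> (forall z, gdeg z (c z)) -> \sum_(z <- s) c z = m -> gdeg d m ->
  d \in s -> c d = m.
Proof.
move=> us hc sm hm ds; apply/eqP; rewrite -subr_eq0; apply/eqP.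
(* Moving m to the left turns the sum into a decomposition of zero. *)
pose c' z := c z - (if z == d then m else 0).
have <- : c' d = c d - m by rewrite /c' eqxx.
apply: (@gdeg_direct _ _ _ _ _ M s c') => // [z|].
  by apply: gdegB => //; case: ifP => [/eqP ->|_] //; apply: gdeg0.
rewrite /c' sumrB sm -big_mkcond /= -big_filter filter_pred1_uniq //.
by rewrite big_seq1 subrr.
Qed.

(** The shift by g is that of a generator in degree g: the component of a in degree
d - g contributes to the degree d. *)
Lemma Lcomp_sum_shift (s : seq int) g a : uniq s ->
  (forall z, Lcomp z a != 0 -> z + g \in s) ->
  \sum_(d <- s) Lcomp (d - g) a = a.
Proof.
move=> us hs; apply/eqP; rewrite -subr_eq0; apply/eqP/(Lcomp_eq0 (pi := pi)) => z.
rewrite linearB linear_sum /=; apply/eqP; rewrite subr_eq0; apply/eqP.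
have E d : Lcomp z (Lcomp (d - g) a) = if d == z + g then Lcomp z a else 0.
  rewrite (Lcomp_deg quadR _ (Ldeg_comp pi _ _)) eq_sym subr_eq.
  by case: eqP => // ->; rewrite addrK.
under eq_bigr => d _ do rewrite E.
rewrite -big_mkcond /=; have [zs|zs] := boolP (z + g \in s).
  by rewrite -big_filter filter_pred1_uniq // big_seq1.
rewrite big1_seq => [|d /andP[/eqP -> ds]]; last by rewrite ds in zs.
by apply/esym/eqP; apply: contraNT zs => /hs.
Qed.

(** A finite range of degrees outside which no linear combination of generators in
the degrees g has components; d is included for convenience of [eval_part]. *)
Lemma degree_range r (g : 'I_r -> int) (d : int) : exists s : seq int,
  [/\ uniq s, d \in s & forall l a,
     \sum_(z <- s) Lcomp (z - g l) a = a].
Proof.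
have [n hn] := Lcomp_bounded quadR pi.
exists (undup (d :: [seq m%:Z + g l | l <- enum 'I_r, m <- iota 0 n.+1])).
split; [exact: undup_uniq|by rewrite mem_undup mem_head|].
move=> l a; apply: Lcomp_sum_shift => [|z az]; first exact: undup_uniq.
rewrite mem_undup inE; apply/orP; right.
have [z0|z0] := ltrP z 0; first by rewrite Lcomp_neg ?eqxx in az.
have [zn|zn] := ltrP n%:Z z; first by rewrite hn ?eqxx in az.
apply/allpairsP; exists (l, absz z); rewrite mem_enum mem_iota /=; split=> //; lia.
Qed.

(** In a relation between homogeneous elements the coefficients may be replaced by
their components of the appropriate degrees. *)
Lemma eval_part (M : gmod) r (g : 'I_r -> int) (v : 'I_r -> L) (x : 'I_r -> M) d m :
  (forall l, gdeg (g l) (x l)) -> \sum_l v l *: x l = m -> gdeg d m ->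
  \sum_l Lcomp (d - g l) (v l) *: x l = m.
Proof.
move=> hx sm hm; have [s [us ds hs]] := degree_range g d.
apply: (@gdeg_part M s (fun z => \sum_l Lcomp (z - g l) (v l) *: x l)) => // [z|].
  apply: gdeg_sum => l; rewrite -[z](subrK (g l)); apply: gdegZ => //.
  by rewrite subrK; apply: Ldeg_comp.
by rewrite exchange_big -sm; apply: eq_bigr => l _; rewrite -scaler_suml hs.
Qed.

Section Free.

Variables (r : nat) (g : 'I_r -> int).

Definition free_deg (d : int) (v : 'rV[L]_r) : Prop :=
  forall l, Ldeg pi (d - g l) (v 0 l).

Lemma free_deg0 d : free_deg d 0.
Proof. by move=> l; rewrite mxE; apply: Ldeg0. Qed.

Lemma free_degB d u v : free_deg d u -> free_deg d v -> free_deg d (u - v).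
Proof. by move=> hu hv l; rewrite !mxE; apply: LdegB. Qed.

Lemma free_degZ z d a v : Ldeg pi z a -> free_deg d v -> free_deg (z + d) (a *: v).
Proof. by move=> ha hv l; rewrite mxE -addrA; apply: LdegM. Qed.

Lemma free_span v : exists (s : seq int) (c : int -> 'rV[L]_r),
  [/\ uniq s, forall d, free_deg d (c d) & v = \sum_(d <- s) c d].
Proof.
have [s [us _ hs]] := degree_range g 0.
exists s, (fun d => \row_l Lcomp (d - g l) (v 0 l)); split=> // [d l|].
  by rewrite mxE; apply: Ldeg_comp.
apply/rowP => l; rewrite summxE -[LHS](hs l); apply: eq_bigr => d _.
by rewrite mxE.
Qed.

Lemma free_direct (s : seq int) (c : int -> 'rV[L]_r) :
  uniq s -> (forall d, free_deg d (c d)) -> \sum_(d <- s) c d = 0 ->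
  forall d, d \in s -> c d = 0.
Proof.
move=> us hc sc d ds; apply/rowP => l; rewrite mxE.
have /(congr1 (fun v : 'rV_r => Lcomp (d - g l) (v 0 l))) := sc.
rewrite summxE mxE linear0 linear_sum (big_rem d) //=.
rewrite (Lcomp_deg quadR _ (hc d l)) eqxx big1_seq ?addr0 // => z /andP[_ zs].
rewrite (Lcomp_deg quadR _ (hc z l)) ifN //.
apply: contraTneq zs => /addIr <-; by rewrite mem_rem_uniqF.
Qed.

Lemma free_findim : exists (n : nat) (b : 'I_n -> 'rV[L]_r),
  forall m, exists c : 'I_n -> k, m = \sum_(i < n) (c i)%:A *: b i.
Proof.
pose V := {ffun 'I_r -> L}; pose b := vbasis {:V}.
exists (\dim {:V}), (fun i => \row_l (b`_i : V) l) => m.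
exists (fun i => coord b i [ffun l => m 0 l]).
apply/rowP => l; have := coord_vbasis (memvf ([ffun l => m 0 l] : V)).
move/(congr1 (fun f : V => f l)); rewrite ffunE => {1}->.
rewrite summxE sum_ffunE; apply: eq_bigr => i _.
by rewrite !mxE ffunE mulr_algl.
Qed.

Definition free_gmod : gmod :=
  @GMod _ _ _ _ _ 'rV[L]_r free_deg free_deg0 free_degB free_degZ free_span
    free_direct free_findim.

End Free.

Section Kernel.

Variables (M N : gmod) (f : {linear M -> N}) (hf : gmorphism f).

Definition ker_deg (d : int) (x : ker_car f) : Prop := gdeg d (val x).

Lemma ker_deg0 d : ker_deg d 0.
Proof. exact: gdeg0. Qed.

Lemma ker_degB d x y : ker_deg d x -> ker_deg d y -> ker_deg d (x - y).
Proof. by rewrite /ker_deg raddfB; apply: gdegB. Qed.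

Lemma ker_degZ z d a x : Ldeg pi z a -> ker_deg d x -> ker_deg (z + d) (a *: x).
Proof. by rewrite /ker_deg linearZ; apply: gdegZ. Qed.

Lemma ker_span x : exists (s : seq int) (c : int -> ker_car f),
  [/\ uniq s, forall d, ker_deg d (c d) & x = \sum_(d <- s) c d].
Proof.
have [s [c [us hc sx]]] := gdeg_span (val x).
have fc d : d \in s -> c d \in ker_pred f.
  have := ker_val_eq0 x; rewrite sx linear_sum => /(gdeg_direct us) h ds.
  by apply/eqP/h => // z; apply: hf.
exists s, (fun d => insubd 0 (c d)); split=> // [d|].
  by rewrite /ker_deg val_insubd; case: ifP => // _; apply: gdeg0.
apply: val_inj; rewrite raddf_sum sx /= [LHS]big_seq [RHS]big_seq.
by apply: eq_bigr => d ds; rewrite val_insubd fc.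
Qed.

Lemma ker_direct (s : seq int) (c : int -> ker_car f) :
  uniq s -> (forall d, ker_deg d (c d)) -> \sum_(d <- s) c d = 0 ->
  forall d, d \in s -> c d = 0.
Proof.
move=> us hc sc d ds; apply: val_inj.
apply: (@gdeg_direct _ _ _ _ _ M s (fun z => val (c z)) us) => //.
by have := congr1 val sc; rewrite raddf_sum.
Qed.

(** The kernel is spanned by the images of a basis of its preimage in k^n, where n
is the size of a spanning family of the whole module. *)
Lemma ker_findim : exists (n : nat) (b : 'I_n -> ker_car f),
  forall x, exists c : 'I_n -> k, x = \sum_(i < n) (c i)%:A *: b i.
Proof.
have [n [b hb]] := gfindim M.
pose ev (c : 'rV[k]_n) := \sum_(i < n) (c 0 i)%:A *: b i.
have evP a u v : ev (a *: u + v) = a%:A *: ev u + ev v.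
  rewrite /ev scaler_sumr -big_split; apply: eq_bigr => i _ /=.
  by rewrite !mxE scalerDl scalerDl scalerA mulr_algl scalerA.
have [||U hU] := @subspace_vspace k 'rV[k]_n (fun c => ev c \in ker_pred f).
- by rewrite /ev big1 ?rpred0 // => i _; rewrite mxE !scale0r.
- by move=> a u v hu hv; rewrite evP rpredD ?rpredZ.
exists (\dim U), (fun i => insubd 0 (ev (vbasis U)`_i)) => x.
have [c hc] := hb (val x).
have cU : (\row_i c i) \in U.
  apply/hU; rewrite /ev; under eq_bigr => i _ do rewrite mxE.
  by rewrite -hc; apply: (valP x).
exists (fun i => coord (vbasis U) i (\row_i c i)); apply: val_inj.
rewrite raddf_sum /= hc; transitivity (ev (\row_i c i)).
  by apply: eq_bigr => i _; rewrite mxE.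
rewrite {1}(coord_vbasis cU); set w := coord _.
transitivity (\sum_(i < \dim U) (w i (\row_i c i))%:A *: ev (vbasis U)`_i).
  apply: (big_rec2 (fun x y => ev x = y)) => [|i y z _ <-]; last exact: evP.
  by rewrite /ev big1 // => i _; rewrite mxE !scale0r.
apply: eq_bigr => i _; rewrite val_insubd ifT //.
by apply/hU/vbasis_mem; apply: mem_nth; rewrite size_tuple.
Qed.

Definition ker_gmod : gmod :=
  @GMod _ _ _ _ _ (ker_car f) ker_deg ker_deg0 ker_degB ker_degZ ker_span
    ker_direct ker_findim.

Definition ker_inc (x : ker_gmod) : M := val x.

Lemma ker_inc_is_linear : linear ker_inc.
Proof. by move=> c x y; rewrite /ker_inc linearP. Qed.

HB.instance Definition _ :=
  GRing.isLinear.Build L ker_gmod M *:%R ker_inc ker_inc_is_linear.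

Lemma ker_inc_inj : injective ker_inc.
Proof. exact: val_inj. Qed.

Lemma ker_inc0 x : f (ker_inc x) = 0.
Proof. exact: ker_val_eq0. Qed.

Lemma ker_inc_onto m : f m = 0 -> exists x, ker_inc x = m.
Proof.
move=> fm; have h : m \in ker_pred f by apply/eqP.
by exists (KerCar h).
Qed.

Lemma ker_gdegE d (x : ker_gmod) : gdeg d x = gdeg d (ker_inc x).
Proof. by []. Qed.

End Kernel.

End GradedModuleTheory.

(** * The graded projectives *)

Section GradedProjectives.

Context (k : fieldType) (Q : quiver) (R : path_alg k Q -> Prop).
Context (quadR : quadratic R) (L : falgType k) (pi : presentation R L).

Local Notation gmod := (gmod pi).
Local Notation gproj := (gproj Q).
Local Notation e := (idem pi).

Lemma gdeg_part_or0 (M : gmod) (s : seq int) (c : int -> M) d m :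
  uniq s -> (forall z, gdeg z (c z)) -> \sum_(z <- s) c z = m -> gdeg d m ->
  m = if d \in s then c d else 0.
Proof.
move=> us hc sm hm; case: ifP => [ds|/negbT ds].
  by rewrite (gdeg_part us hc sm hm).
pose c' z := if z == d then 0 else c z.
have <- : c' d = m; last by rewrite /c' eqxx.
apply: (@gdeg_part _ _ _ _ _ M (d :: s)); rewrite /= ?us ?ds ?mem_head //.
  by move=> z; rewrite /c'; case: eqP => // ->; apply: gdeg0.
rewrite big_cons /c' eqxx add0r -sm; apply: eq_big_seq => z zs.
by rewrite ifN //; apply: contraNneq ds => <-.
Qed.

(** A preimage of a homogeneous element has a component which is still a preimage. *)
Lemma gdeg_lift (M N : gmod) (g : {linear M -> N}) (m : M) (n : N) d :
  gmorphism g -> g m = n -> gdeg d n -> exists2 m', gdeg d m' & g m' = n.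
Proof.
move=> hg gm hn; have [s [c [us hc sm]]] := gdeg_span m.
have := @gdeg_part_or0 N s (fun z => g (c z)) d n us.
rewrite -linear_sum -sm gm => /(_ (fun z => hg _ _ (hc z)) erefl hn).
case: ifP => _ ->; first by exists (c d).
by exists 0; [apply: gdeg0|rewrite linear0].
Qed.

Section IdempotentDefect.

Variable (P : gproj).

Local Notation F := (free_gmod quadR pi (@ggen Q P)).

Definition idem_defect (v : F) : F := \row_j (v 0 j * e (gvtx j) - v 0 j).

Lemma idem_defect_is_linear : linear idem_defect.
Proof.
move=> c u v; apply/rowP => j; rewrite !mxE mulrDl mulrBr mulrA.
by rewrite opprD addrACA.
Qed.

HB.instance Definition _ := GRing.isLinear.Build L F F *:%R idem_defect idem_defect_is_linear.

Lemma idem_defect_gmorphism : gmorphism idem_defect.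
Proof.
move=> d v hv j; rewrite mxE; apply: (LdegB quadR) => //.
by rewrite -[d - _]addr0; apply: LdegM => //; apply: Ldeg_idem.
Qed.

(** A direct sum of shifts of modules L e_x, cut out of a free module as the kernel
of v |-> (v_j e_(x_j) - v_j)_j. *)
Definition gproj_gmod : gmod := ker_gmod (f := idem_defect) idem_defect_gmorphism.

Definition gvec (w : gproj_gmod) : 'rV[L]_(grk P) := ker_inc w.

Lemma gvec_is_linear : linear gvec.
Proof. by move=> c u v; rewrite /gvec linearP. Qed.

HB.instance Definition _ :=
  GRing.isLinear.Build L gproj_gmod 'rV[L]_(grk P) *:%R gvec gvec_is_linear.

Lemma gvec_inj : injective gvec.
Proof. exact: ker_inc_inj. Qed.

Lemma gvec_in w : in_gproj pi (gvec w).
Proof.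
move=> j; have /(congr1 (fun v : 'rV_(grk P) => v 0 j)) := ker_inc0 w.
by rewrite !mxE => /eqP; rewrite subr_eq0 => /eqP.
Qed.

Lemma gvec_onto v : in_gproj pi v -> exists w, gvec w = v.
Proof.
move=> hv; apply: ker_inc_onto; apply/rowP => j.
by rewrite !mxE hv subrr.
Qed.

Lemma gvec_deg d w : gdeg d w <-> gproj_deg pi d (gvec w).
Proof. by split=> [h|[_ h]] //; split=> //; apply: gvec_in. Qed.

Definition gproj_gen (j : 'I_(grk P)) : gproj_gmod :=
  sval (cid (@gvec_onto (\row_l if l == j then e (gvtx j) else 0)
    (fun l => ltac:(by rewrite mxE; case: eqP => [->|_]; rewrite ?mul0r ?idemM ?eqxx)))).

Lemma gproj_genE j : gvec (gproj_gen j) = \row_l if l == j then e (gvtx j) else 0.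
Proof. by rewrite /gproj_gen; case: cid. Qed.

Lemma gproj_gen_gens : gproj_gens gproj_gen.
Proof.
move=> j; split.
  apply: gvec_inj; rewrite linearZ /= gproj_genE; apply/rowP => l; rewrite !mxE.
  by case: eqP => _; rewrite ?mulr0 ?idemM ?eqxx.
apply/gvec_deg; split; first exact: gvec_in.
move=> l; rewrite gproj_genE mxE; case: eqP => [->|_]; last exact: Ldeg0.
by rewrite subrr; apply: Ldeg_idem.
Qed.

Lemma gproj_gen_sum w : w = \sum_j gvec w 0 j *: gproj_gen j.
Proof.
have E j l : gvec (gvec w 0 j *: gproj_gen j) 0 l = if l == j then gvec w 0 j else 0.
  rewrite linearZ /= gproj_genE mxE mxE; case: ifP => _; last exact: mulr0.
  exact: gvec_in.
apply: gvec_inj; rewrite linear_sum; apply/rowP => l; rewrite summxE.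
rewrite (bigD1 l) //= [X in X + _]E eqxx big1 ?addr0 // => j jl.
by apply: etrans (E j l) _; rewrite eq_sym (negPf jl).
Qed.

Section Eval.

Variables (M : gmod) (eps : 'I_(grk P) -> M).

Definition gproj_lin (w : gproj_gmod) : M := gproj_eval eps (gvec w).

Lemma gproj_lin_is_linear : linear gproj_lin.
Proof.
move=> c u v; rewrite /gproj_lin /gproj_eval scaler_sumr -big_split /=.
by apply: eq_bigr => j _; rewrite linearP !mxE scalerDl scalerA.
Qed.

HB.instance Definition _ :=
  GRing.isLinear.Build L gproj_gmod M *:%R gproj_lin gproj_lin_is_linear.

Hypothesis eps_gens : gproj_gens eps.

Lemma gproj_lin_gmorphism : gmorphism gproj_lin.
Proof.
move=> d w /gvec_deg [_ hw]; apply: gdeg_sum => j.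
by rewrite -[d](subrK (ggen j)); apply: gdegZ => //; apply: (eps_gens j).2.
Qed.

Lemma gproj_eval_in v :
  exists2 v', in_gproj pi v' & gproj_eval eps v' = gproj_eval eps v.
Proof.
exists (\row_j (v 0 j * e (gvtx j))) => [j|].
  by rewrite mxE -mulrA idemM eqxx.
by apply: eq_bigr => j _; rewrite mxE -scalerA (eps_gens j).1.
Qed.

Lemma gproj_lin_gen j : gproj_lin (gproj_gen j) = eps j.
Proof.
rewrite /gproj_lin /gproj_eval gproj_genE (bigD1 j) //= mxE eqxx (eps_gens j).1.
by rewrite big1 ?addr0 // => l lj; rewrite mxE (negPf lj) scale0r.
Qed.

End Eval.

(** A map out of the module is determined by arbitrary images of the generators, as
long as these are homogeneous of the right degree and fixed by the right
idempotent; surjectivity provides such preimages. *)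
Lemma gproj_projective : projective gproj_gmod.
Proof.
move=> M N g f hg hf sg.
have ex j : exists m : M, [/\ e (gvtx j) *: m = m, gdeg (ggen j) m
    & g m = f (gproj_gen j)].
  have [m0 gm0] := sg (f (gproj_gen j)).
  have [hj dj] := gproj_gen_gens j.
  have [m1 hm1 gm1] := gdeg_lift hg gm0 (hf _ _ dj).
  exists (e (gvtx j) *: m1); split; first by rewrite scalerA idemM eqxx.
    exact: gdeg_idem.
  by rewrite linearZ /= gm1 -linearZ /= hj.
pose m j := sval (cid (ex j)).
have hm j : [/\ e (gvtx j) *: m j = m j, gdeg (ggen j) (m j)
    & g (m j) = f (gproj_gen j)] by rewrite /m; case: cid.
have gm : gproj_gens m by move=> j; have [] := hm j.
exists (gproj_lin m); split; first exact: gproj_lin_gmorphism.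
move=> w; rewrite /= /gproj_lin /gproj_eval linear_sum [in RHS](gproj_gen_sum w).
by rewrite linear_sum; apply: eq_bigr => j _; rewrite !linearZ /=; have [_ _ ->] := hm j.
Qed.

End IdempotentDefect.

(** The components at each vertex and in each degree of a spanning family. *)
Lemma finite_gens (M : gmod) : exists (P : gproj) (eps : 'I_(grk P) -> M),
  gproj_gens eps /\ gproj_onto eps.
Proof.
have [n [b hb]] := gfindim M.
have ex i : exists sc : seq int * (int -> M), [/\ uniq sc.1,
    forall d, gdeg d (sc.2 d) & b i = \sum_(d <- sc.1) sc.2 d].
  by have [s [c ?]] := gdeg_span (b i); exists (s, c).
pose s i := (sval (cid (ex i))).1; pose c i := (sval (cid (ex i))).2.
have hs i : [/\ uniq (s i), forall d, gdeg d (c i d)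
    & b i = \sum_(d <- s i) c i d] by rewrite /s /c; case: cid.
(* Generators are indexed by a spanning vector, one of its degrees, a vertex. *)
pose T := ({i : 'I_n & 'I_(size (s i))} * vert Q)%type.
pose dg (t : T) : int := (s (tag t.1))`_(tagged t.1).
pose el (t : T) := e t.2 *: c (tag t.1) (dg t).
pose P := @GProj Q #|{: T}| (fun j => (enum_val j : T).2) (fun j => dg (enum_val j)).
pose eps (j : 'I_(grk P)) : M := el (enum_val j).
have ge : gproj_gens eps.
  move=> j; split; first by rewrite scalerA idemM eqxx.
  by apply: gdeg_idem; have [_ + _] := hs (tag (enum_val j).1); apply.
exists P, eps; split=> // m; have [a ->] := hb m.
suff [v <-] : exists v, gproj_eval (P := P) eps v = \sum_(i < n) (a i)%:A *: b i.
  have [v' hv' ev'] := gproj_eval_in ge v; by exists v'.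
exists (\row_j (a (tag (enum_val j).1))%:A).
rewrite /gproj_eval.
under eq_bigr => j _ do rewrite mxE.
rewrite -(big_enum_val (fun t : T => (a (tag t.1))%:A *: el t)) /=.
have H i : (a i)%:A *: b i =
    \sum_(j < size (s i)) \sum_x (a i)%:A *: (e x *: c i (s i)`_j).
  have [_ _ ->] := hs i; rewrite (big_nth 0) big_mkord scaler_sumr.
  apply: eq_bigr => j _; rewrite -scaler_sumr; congr (_ *: _).
  by rewrite -scaler_suml idem_sum scale1r.
rewrite [RHS](eq_bigr _ (fun i _ => H i)).
rewrite sig_big_dep pair_big /=; apply: eq_bigr => t _; by rewrite /el /dg.
Qed.

End GradedProjectives.

(** * Existence of minimal resolutions *)

Section MinimalResolution.

Context (k : fieldType) (Q : quiver) (R : path_alg k Q -> Prop).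
Context (quadR : quadratic R) (L : falgType k) (pi : presentation R L).

Local Notation gmod := (gmod pi).
Local Notation gproj := (gproj Q).
Local Notation e := (idem pi).
Local Notation Lcomp := (Lcomp pi).

(** If a relation has a coefficient outside of the radical, its part in the degree
of the corresponding generator expresses this generator by the others: the
degree 0 part of the coefficient is a nonzero scalar multiple of an idempotent. *)
Lemma remove_generator (M : gmod) (P : gproj) (eps : 'I_(grk P) -> M)
    (v : 'rV[L]_(grk P)) (j : 'I_(grk P)) :
  gproj_gens eps -> gproj_onto eps -> in_gproj pi v -> gproj_eval eps v = 0 ->
  ~ Lrad pi (v 0 j) ->
  exists (P' : gproj) (eps' : 'I_(grk P') -> M),
    [/\ gproj_gens eps', gproj_onto eps' & (grk P' < grk P)%N].
Proof.
case: P eps v j => -[|r] x g eps v j ge oe iv ev rj; first by case: j rj.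
pose a := Lcomp 0 (v 0 j).
have aE : a = a * e (x j).
  by rewrite /a -[in LHS](iv j) (Lcomp_mulr quadR _ _ (Ldeg_idem _ _)) subr0.
have [c ca] : exists c : k, a = c *: e (x j).
  have [c ac] := Ldeg0_span (Ldeg_comp pi 0 (v 0 j)); exists (c (x j)).
  rewrite aE /a ac mulr_suml (bigD1 (x j)) //= big1 ?addr0 => [|y yx].
    by rewrite -scalerAl idemM eqxx.
  by rewrite -scalerAl idemM (negPf yx) scaler0.
have c0 : c != 0.
  apply: contra_not_neq rj => c0; apply/(LradP quadR).
  by rewrite -/a ca c0 scale0r.
pose P' := @GProj Q r (fun l => x (lift j l)) (fun l => g (lift j l)).
pose eps' (l : 'I_(grk P')) : M := eps (lift j l).
have ge' : gproj_gens eps' by move=> l; apply: (ge (lift j l)).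
exists P', eps'; split=> // m.
have := eval_part (d := g j) quadR (fun l => (ge l).2) ev (gdeg0 _ _).
rewrite (bigD1_ord j) //= subrr -/a ca.
rewrite -[c *: e _]mulr_algl -scalerA (ge j).1 => /eqP.
rewrite addr_eq0 => /eqP /(congr1 (fun y => (c^-1)%:A *: y)).
rewrite scalerA mulr_algl scalerA mulVf // !scale1r => ej.
have [w _ <-] := oe m.
suff [w' <-] : exists w', gproj_eval (P := P') eps' w' = gproj_eval eps w.
  exact: (gproj_eval_in ge' w').
exists (\row_l (w 0 (lift j l) - w 0 j * (c^-1)%:A * Lcomp (g j - g (lift j l)) (v 0 (lift j l)))).
rewrite /gproj_eval [RHS](bigD1_ord j) //= [in RHS]ej scalerN scaler_sumr scalerN scaler_sumr.
rewrite addrC -sumrB; apply: eq_bigr => l _.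
by rewrite mxE scalerBl !scalerA.
Qed.

(** A generating family of minimal size is a projective cover, by
[remove_generator]. *)
Lemma minimal_cover (M : gmod) : exists (P : gproj) (eps : 'I_(grk P) -> M),
  [/\ gproj_gens eps, gproj_onto eps
    & forall v, in_gproj pi v -> gproj_eval eps v = 0 -> forall j, Lrad pi (v 0 j)].
Proof.
pose A r := `[< exists (P : gproj) (eps : 'I_(grk P) -> M),
  [/\ gproj_gens eps, gproj_onto eps & grk P = r] >].
have [P0 [eps0 [g0 o0]]] := finite_gens M.
have exA : exists r, A r by exists (grk P0); apply/asboolP; exists P0, eps0.
case: (ex_minnP exA) => r /asboolP [P [eps [ge oe rP]]] min_r.
exists P, eps; split=> // v iv ev j.
apply: contrapT => /(remove_generator ge oe iv ev) [P' [eps' [ge' oe' lt]]].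
have : A (grk P') by apply/asboolP; exists P', eps'.
by move/min_r; rewrite leqNgt -rP lt.
Qed.

(** Projective covers as data, to be iterated in [syz]. *)
Record cover (M : gmod) := Cover {
  cov_proj : gproj;
  cov_map : 'I_(grk cov_proj) -> M;
  cov_gens : gproj_gens cov_map;
  cov_onto : gproj_onto cov_map;
  cov_min : forall v, in_gproj pi v -> gproj_eval cov_map v = 0 ->
    forall j, Lrad pi (v 0 j)
}.

Lemma cover_exists (M : gmod) : inhabited (cover M).
Proof. by have [P [eps [g o m]]] := minimal_cover M; exists; exists P eps. Qed.

Definition the_cover (M : gmod) : cover M := inhabited_witness (cover_exists M).

Definition cover_ker (M : gmod) : gmod :=
  ker_gmod (gproj_lin_gmorphism (quadR := quadR) (cov_gens (c := the_cover M))).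

Fixpoint syz (M : gmod) (n : nat) : gmod :=
  if n is n'.+1 then cover_ker (syz M n') else M.

Definition res_term (M : gmod) (n : nat) : gproj := cov_proj (the_cover (syz M n)).

Definition res_incl (M : gmod) (n : nat) (m : syz M n.+1) :
  'rV[L]_(grk (res_term M n)) := gvec (ker_inc m).

Definition res_diff (M : gmod) (n : nat) :
    'M[L]_(grk (res_term M n.+1), grk (res_term M n)) :=
  \matrix_(j, l) res_incl (cov_map (c := the_cover (syz M n.+1)) j) 0 l.

Lemma res_incl_is_linear M n : linear (@res_incl M n).
Proof. by move=> c u v; rewrite /res_incl !linearP. Qed.

HB.instance Definition _ M n :=
  GRing.isLinear.Build L (syz M n.+1) 'rV[L]_(grk (res_term M n)) *:%R
    (@res_incl M n) (@res_incl_is_linear M n).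

Lemma res_incl_inj M n : injective (@res_incl M n).
Proof. by move=> u v /gvec_inj /ker_inc_inj. Qed.

Lemma res_inclP M n v :
  (exists m, @res_incl M n m = v) <->
  in_gproj pi v /\ gproj_eval (cov_map (c := the_cover (syz M n))) v = 0.
Proof.
split=> [[m <-]|[iv ev]].
  by split; [apply: gvec_in|apply: (ker_inc0 m)].
have [w wv] := gvec_onto quadR iv.
have [|m mw] := @ker_inc_onto _ _ _ _ _ _ _ _
  (gproj_lin_gmorphism (quadR := quadR) (cov_gens (c := the_cover (syz M n)))) w.
  by rewrite /= /gproj_lin wv.
by exists m; rewrite /res_incl mw.
Qed.

Lemma res_diff_mul M n v :
  v *m res_diff M n =
  res_incl (gproj_eval (cov_map (c := the_cover (syz M n.+1))) v).
Proof.
rewrite /gproj_eval linear_sum /=; apply/rowP => l; rewrite mxE summxE.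
by apply: eq_bigr => j _; rewrite linearZ !mxE.
Qed.

Lemma res_diff_map M n : gproj_map pi (res_diff M n).
Proof.
move=> j l; rewrite mxE.
have [ej dj] := cov_gens (c := the_cover (syz M n.+1)) j.
have iv := gvec_in (ker_inc (cov_map (c := the_cover (syz M n.+1)) j)).
split; last by have /gvec_deg [_ h] := dj; apply: h.
rewrite -mulrA iv -/(res_incl _).
by rewrite -[in RHS]ej linearZ mxE.
Qed.

Definition min_res (M : gmod) : gseq pi := GSeq (@res_diff_map M).

Lemma min_resP M : min_resolution (min_res M) M.
Proof.
split; last first.
  move=> i j l; rewrite mxE.
  have /res_inclP [iv ev] : exists m, @res_incl M i m =
    res_incl (cov_map (c := the_cover (syz M i.+1)) j) by eexists.
  exact: cov_min iv ev l.
exists (cov_map (c := the_cover M)); split.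
- exact: cov_gens.
- exact: cov_onto.
- move=> v iv; split=> [ev|[w _ <-]].
    have /(res_inclP (n := 0%N)) [m <-] := conj iv ev.
    have [w iw <-] := cov_onto (the_cover (syz M 1)) m.
    by exists w => //; rewrite res_diff_mul.
  rewrite res_diff_mul.
  by have /(res_inclP (n := 0%N)) [] : exists m, @res_incl M 0 m = res_incl
     (gproj_eval (cov_map (c := the_cover (syz M 1))) w) by eexists.
- move=> i v iv; rewrite res_diff_mul; split=> [ev|[w _ <-]].
    have e0 : gproj_eval (cov_map (c := the_cover (syz M i.+1))) v = 0.
      by apply: res_incl_inj; rewrite ev linear0.
    have /res_inclP [m <-] := conj iv e0.
    have [w iw <-] := cov_onto (the_cover (syz M i.+2)) m.
    by exists w => //; rewrite res_diff_mul.
  rewrite res_diff_mul.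
  have /res_inclP [_ ->] : exists m, @res_incl M i.+1 m = res_incl
     (gproj_eval (cov_map (c := the_cover (syz M i.+2))) w) by eexists.
  by rewrite linear0.
Qed.

End MinimalResolution.

(** * Comparison of resolutions *)

Section Comparison.

Context (k : fieldType) (Q : quiver) (R : path_alg k Q -> Prop).
Context (quadR : quadratic R) (L : falgType k) (pi : presentation R L).

Local Notation gmod := (gmod pi).
Local Notation gproj := (gproj Q).
Local Notation e := (idem pi).

(** Projectivity is stated for surjections; exactness at B makes A surject onto the
kernel of u, through which f factors. *)
Lemma exact_lift (P A B C : gmod) (g : {linear A -> B}) (u : {linear B -> C})
    (f : {linear P -> B}) :
  projective P -> gmorphism g -> gmorphism u -> gmorphism f ->
  (forall b, u b = 0 <-> exists a, g a = b) -> (forall p, u (f p) = 0) ->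
  exists h : {linear P -> A}, gmorphism h /\ forall p, g (h p) = f p.
Proof.
move=> projP hg hu hf ex uf.
have ug a : u (g a) = 0 by apply/ex; exists a.
pose cores (D : gmod) (v : {linear D -> B}) (uv : forall x, u (v x) = 0) (x : D)
  : ker_gmod hu := sval (cid (ker_inc_onto hu (uv x))).
have coresE D v uv x : ker_inc (@cores D v uv x) = v x by rewrite /cores; case: cid.
have lc D v uv : linear (@cores D v uv).
  move=> c x y; apply: ker_inc_inj; rewrite linearP /= !coresE. exact: linearP.
have hc (D : gmod) (v : {linear D -> B}) uv : gmorphism v -> gmorphism (@cores D v uv).
  by move=> hv d x hx; rewrite ker_gdegE coresE; apply: hv.
have [||y|h [hh gh]] := projP _ _ (lin_of (lc A g ug)) (lin_of (lc P f uf)).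
- exact: hc.
- exact: hc.
- have [a ga] : exists a, g a = ker_inc y by apply/ex/ker_inc0.
  by exists a; apply: ker_inc_inj; rewrite coresE.
exists h; split=> // p.
have : ker_inc (cores A g ug (h p)) = ker_inc (cores P f uf p).
  by rewrite [RHS](congr1 (@ker_inc _ _ _ _ _ _ _ _ hu) (esym (gh p))).
by rewrite !coresE.
Qed.

(** An exact augmented complex of arbitrary graded modules, so that [comparison]
applies in both directions between projective resolutions of either kind. *)
Record aug_exact (M : gmod) := AugExact {
  ae_term : nat -> gmod;
  ae_diff : forall i, {linear ae_term i.+1 -> ae_term i};
  ae_aug : {linear ae_term 0%N -> M};
  ae_diff_gm : forall i, gmorphism (ae_diff i);
  ae_aug_gm : gmorphism ae_aug;
  ae_aug_onto : surjective_map ae_aug;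
  ae_exact0 : forall v, ae_aug v = 0 <-> exists w, ae_diff 0%N w = v;
  ae_exactS : forall i v, ae_diff i v = 0 <-> exists w, ae_diff i.+1 w = v
}.

Section Maps.

Variables (M : gmod) (X Y : aug_exact M).

(** The differential out of the i-th term, with the augmentation as the case
i = 0. *)
Definition ae_tgt (Z : aug_exact M) (i : nat) : gmod :=
  if i is i'.+1 then ae_term Z i' else M.

Definition ae_out (Z : aug_exact M) (i : nat) : {linear ae_term Z i -> ae_tgt Z i} :=
  match i with 0%N => ae_aug Z | i'.+1 => ae_diff Z i' end.

Lemma ae_out_gm Z i : gmorphism (ae_out Z i).
Proof. by case: i => [|i]; [apply: ae_aug_gm|apply: ae_diff_gm]. Qed.

Lemma ae_out_exact (Z : aug_exact M) i v :
  ae_out Z i v = 0 <-> exists w, ae_diff Z i w = v.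
Proof. by case: i v => [|i] v; [apply: ae_exact0|apply: ae_exactS]. Qed.

Hypothesis projX : forall i, projective (ae_term X i).

(** What the construction of a chain map has to remember about its i-th component in
order to continue: the composite with the differential of X consists of cycles. *)
Definition liftable i (f : {linear ae_term X i -> ae_term Y i}) : Prop :=
  gmorphism f /\ forall w, ae_out Y i (f (ae_diff X i w)) = 0.

Lemma lift_step i (f : {linear ae_term X i -> ae_term Y i}) :
  liftable f -> exists f' : {linear ae_term X i.+1 -> ae_term Y i.+1},
    liftable f' /\ forall w, ae_diff Y i (f' w) = f (ae_diff X i w).
Proof.
case=> hf of0.
pose fd w := f (ae_diff X i w).
have lfd : linear fd by move=> c u v; rewrite /fd !linearP.
have [|h [hh gh]] := @exact_lift _ _ _ _ (ae_diff Y i) (ae_out Y i) (lin_of lfd)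
  (@projX i.+1) (@ae_diff_gm _ _ i) (@ae_out_gm _ i) _ (@ae_out_exact Y i) of0.
  by move=> d w hw; apply/hf/ae_diff_gm.
exists h; split=> //; split=> // w; apply: etrans (gh _) _.
have E : ae_diff X i (ae_diff X i.+1 w) = 0 by apply/ae_exactS; exists w.
by rewrite /= /lin_of /fd E linear0.
Qed.

Lemma comparison : exists f : forall i, {linear ae_term X i -> ae_term Y i},
  (forall w, ae_aug Y (f 0%N w) = ae_aug X w) /\
  (forall i w, ae_diff Y i (f i.+1 w) = f i (ae_diff X i w)).
Proof.
have [f0 [hf0 af0]] := projX (@ae_aug_gm _ Y) (@ae_aug_gm _ X) (@ae_aug_onto _ Y).
have lf0 : liftable f0 by split=> // w; rewrite [LHS]af0; apply/ae_exact0; exists w.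
pose next i (f : {f | @liftable i f}) : {f | @liftable i.+1 f} :=
  let c := cid (lift_step (svalP f)) in exist _ (sval c) (svalP c).1.
pose F := fix F i : {f | @liftable i f} :=
  if i is i'.+1 then next i' (F i') else exist _ f0 lf0.
exists (fun i => sval (F i)); split=> // i w.
exact: (svalP (cid (lift_step (svalP (F i))))).2.
Qed.

End Maps.

Section FromSequence.

Variables (C : gseq pi) (M : gmod).

Local Notation G i := (gproj_gmod quadR pi (gterm C i)).

Lemma gdiff_row_in i j : in_gproj pi (row j (gdiff C i)).
Proof.
by move=> l; rewrite mxE; have [<- _] := @gdiff_map _ _ _ _ _ C i j l; rewrite -!mulrA idemM eqxx.
Qed.

(** The image of the j-th generator under the differential. *)
Definition diff_row i (j : 'I_(grk (gterm C i.+1))) : G i :=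
  sval (cid (gvec_onto quadR (@gdiff_row_in i j))).

Lemma diff_rowE i j : gvec (@diff_row i j) = row j (gdiff C i).
Proof. by rewrite /diff_row; case: cid. Qed.

Lemma diff_row_gens i : gproj_gens (@diff_row i).
Proof.
move=> j; split.
  apply: gvec_inj; rewrite linearZ /= diff_rowE; apply/rowP => l; rewrite !mxE.
  by have [<- _] := @gdiff_map _ _ _ _ _ C i j l; rewrite !mulrA idemM eqxx.
apply/gvec_deg; split; first exact: gvec_in.
by move=> l; rewrite diff_rowE mxE; have [] := @gdiff_map _ _ _ _ _ C i j l.
Qed.

Definition seq_diff i : {linear G i.+1 -> G i} := gproj_lin (@diff_row i).

Lemma seq_diffE i w : gvec (seq_diff i w) = gvec w *m gdiff C i.
Proof.
rewrite /= /gproj_lin /gproj_eval linear_sum; apply/rowP => l; rewrite summxE mxE.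
by apply: eq_bigr => j _; rewrite linearZ /= diff_rowE !mxE.
Qed.

(** A resolution by matrices is an exact augmented complex of graded modules. *)
Lemma seq_exact : resolves C M -> exists eps : {linear G 0%N -> M},
  [/\ gmorphism eps, surjective_map eps,
    forall v, eps v = 0 <-> exists w, seq_diff 0 w = v
  & forall i v, seq_diff i v = 0 <-> exists w, seq_diff i.+1 w = v].
Proof.
case=> eps [ge oe ex0 exS].
exists (gproj_lin eps); split.
- exact: gproj_lin_gmorphism.
- move=> m; have [v iv <-] := oe m; have [w <-] := gvec_onto quadR iv.
  by exists w.
- move=> v; rewrite /= /gproj_lin; split.
    move/(ex0 _ (gvec_in v)) => [w iw wv]; have [w' ww'] := gvec_onto quadR iw.
    by exists w'; apply: gvec_inj; rewrite (seq_diffE w') ww'.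
  case=> w <-; apply/(ex0 _ (gvec_in _)); exists (gvec w); first exact: gvec_in.
  by rewrite (seq_diffE w).
move=> i v; split.
  move=> dv; have /(exS _ _ (gvec_in v)) : gvec v *m gdiff C i = 0.
    by rewrite -seq_diffE dv linear0.
  case=> w iw wv; have [w' ww'] := gvec_onto quadR iw.
  by exists w'; apply: gvec_inj; rewrite (seq_diffE w') ww'.
case=> w <-; apply: gvec_inj; rewrite linear0 seq_diffE.
apply/(exS _ _ (gvec_in _)); exists (gvec w); first exact: gvec_in.
by rewrite (seq_diffE w).
Qed.

End FromSequence.

End Comparison.

(** * Length of the minimal resolution *)

Section ResolutionLength.

Context (k : fieldType) (Q : quiver) (R : path_alg k Q -> Prop).
Context (quadR : quadratic R) (L : falgType k) (pi : presentation R L).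

Local Notation gmod := (gmod pi).
Local Notation gproj := (gproj Q).
Local Notation e := (idem pi).
Local Notation G P := (gproj_gmod quadR pi P).

Lemma gproj0_zero (P : gproj) (w : G P) : grk P = 0%N -> w = 0.
Proof.
move=> P0; apply: gvec_inj; apply/rowP => j.
by have := ltn_ord j; rewrite {2}P0.
Qed.

Lemma gproj_zero0 (P : gproj) : (forall w : G P, w = 0) -> grk P = 0%N.
Proof.
move=> h; apply/eqP; rewrite -leqn0 leqNgt; apply/negP => P0.
have := congr1 (fun w => gvec w 0 (Ordinal P0)) (h (gproj_gen quadR pi (Ordinal P0))).
rewrite gproj_genE linear0 !mxE eqxx; apply/eqP; exact: idem_neq0.
Qed.

Lemma has_proj_res_of_gseq (C : gseq pi) (M : gmod) n : resolves C M ->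
  (forall i, (n < i)%N -> grk (gterm C i) = 0%N) -> has_proj_res M n.
Proof.
move=> resC C0; have [eps [heps eo ex0 exS]] := seq_exact quadR resC.
exists (fun i => G (gterm C i)), (seq_diff quadR C), eps; split=> //.
- by move=> i; apply: gproj_projective.
- by split=> // i; apply: gproj_lin_gmorphism; apply: diff_row_gens.
- by move=> i ni v; apply: gproj0_zero; apply: C0.
Qed.

(** Membership in the n-th power of the radical times the module. *)
Definition gvec_ge (P : gproj) n (w : G P) := forall j, Lge pi n (gvec w 0 j).

Lemma gvec_ge_linear (P P' : gproj) (h : {linear G P -> G P'}) n m w :
  (forall u, gvec_ge m (h u)) -> gvec_ge n w -> gvec_ge (n + m) (h w).
Proof.
move=> hm wn l; rewrite [w]gproj_gen_sum linear_sum linear_sum summxE.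
apply: Lge_sum => j; rewrite linearZ linearZ mxE.
by apply: LgeM => //; apply: hm.
Qed.

Lemma iter_linear (A : nzRingType) (U : lmodType A) (h : {linear U -> U}) n :
  linear (iter n h).
Proof. by elim: n => [|n IHn] c u v //; rewrite !iterS IHn linearP. Qed.

(** Such a map increases the radical filtration, which is finite. *)
Lemma rad_nilp (P : gproj) (h : {linear G P -> G P}) :
  (forall w, gvec_ge 1 (h w)) -> exists N, forall w, iter N h w = 0.
Proof.
move=> h1; have [N hN] := Lge_nilp quadR pi; exists N => w.
have H : forall n, gvec_ge n (iter n h w).
  elim=> [j|n IHn]; first exact: Lge0.
  by rewrite iterS -addn1; apply: gvec_ge_linear.
by apply: gvec_inj; rewrite linear0; apply/rowP => j; rewrite mxE; apply/hN/H.
Qed.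

(** With chain maps f, g as in [comparison] in both directions, h = 1 - g f is a chain
map over the zero map of M.  If the N-th power of h_i is zero, that of h_(i+1)
has values in the cycles, which are contained in the radical by minimality; hence
h_(i+1) is nilpotent.  For i > n it is the identity, as f_i = 0. *)
Lemma min_resolution_length (C : gseq pi) (M : gmod) n :
  min_resolution C M -> has_proj_res M n ->
  forall i, (n < i)%N -> grk (gterm C i) = 0%N.
Proof.
case=> resC radC [P [d [epsP [projP [hepsP hd] oP [exP0 exPS] P0]]]].
have [eps [heps eo ex0 exS]] := seq_exact quadR resC.
pose X := @AugExact _ _ _ _ _ M (fun i => G (gterm C i)) (seq_diff quadR C) eps
  (fun i => gproj_lin_gmorphism (@diff_row_gens _ _ _ quadR _ _ C i)) heps eo ex0 exS.
pose Y := @AugExact _ _ _ _ _ M P d epsP hd hepsP oP exP0 exPS.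
have [f [f0 fS]] := @comparison _ _ _ _ _ _ X Y
  (fun i => @gproj_projective _ _ _ quadR _ pi (gterm C i)).
have [g [g0 gS]] := @comparison _ _ _ _ _ _ Y X projP.
rewrite /= in f f0 fS g g0 gS.
pose r i (w : G (gterm C i)) := w - g i (f i w).
have lr i : linear (@r i).
  by move=> c u v; rewrite /r !linearP /= scalerDr addrACA.
pose h i : {linear G (gterm C i) -> G (gterm C i)} := lin_of (lr i).
have hd' i w : seq_diff quadR C i (h i.+1 w) = h i (seq_diff quadR C i w).
  rewrite /h /= /lin_of /r linearB; congr (_ - _).
  by apply: etrans (gS _ _) _; congr (g i _); apply: fS.
have h0 w : eps (h 0%N w) = 0.
  by rewrite /h /= /lin_of /r linearB /= g0 f0 subrr.
have rad_diff i w : gvec_ge 1 (seq_diff quadR C i w).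
  move=> l; rewrite seq_diffE mxE; apply: Lge_sum => j.
  apply: (@LgeM _ _ _ quadR _ _ 0); first exact: Lge0.
  by apply/(Lge1P quadR).
(* [h i] has values in the radical for i = 0; later only its N-th power does. *)
have nilp : forall i, exists N, forall w, iter N (h i) w = 0.
  elim=> [|i [N hN]].
    by apply: rad_nilp => w; have /ex0 [v <-] := h0 w.
  have hNd w : seq_diff quadR C i (iter N (h i.+1) w) = 0.
    rewrite -(hN (seq_diff quadR C i w)).
    elim: (N) w => [//|m IHm] w.
    by apply: etrans (hd' _ _) _; congr (h i _); apply: IHm.
  have [|m hm] := @rad_nilp _ (lin_of (iter_linear (h i.+1) N)).
    move=> w; have [v E] := (exS i _).1 (hNd w).
    by rewrite [X in gvec_ge 1 X](esym E : _ = seq_diff quadR C i.+1 v).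
  by exists (m * N)%N => w; rewrite iterM; apply: hm.
move=> i ni; apply: gproj_zero0 => w; have [N hN] := nilp i.
rewrite -(hN w); elim: N {hN} => //= N <-.
by rewrite /lin_of /r (P0 i ni (f i w)) linear0 subr0.
Qed.

End ResolutionLength.

(** * Linear algebra *)

(** Cramer's rule: det C * q = adj C * (C q), where only C q depends on q on the right
hand side. *)
Lemma bounded_solutions (A : idomainType) n (C : 'M[{poly A}]_n) (N : nat) :
  \det C != 0 -> exists B : nat, forall q : 'cV[{poly A}]_n,
    (forall a, (size ((C *m q) a 0%R) <= N)%N) -> forall b, (size (q b 0%R) <= B)%N.
Proof.
move=> C0; pose S := (\max_a \max_b size ((\adj C) a b))%N.
exists (S + N)%N => q hq b.
have [->|qb0] := eqVneq (q b 0) 0; first by rewrite size_poly0.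
apply: (@leq_trans (size (\det C * q b 0))).
  rewrite size_mul //; have : (0 < size (\det C))%N by rewrite size_poly_gt0.
  by case: (size (\det C)) => // s _; rewrite addSn leq_addl.
have -> : \det C * q b 0 = ((\adj C) *m (C *m q)) b 0.
  by rewrite mulmxA mul_adj_mx mul_scalar_mx mxE.
rewrite mxE; apply: (leq_trans (size_sum _ _ _)); apply/bigmax_leqP => a _.
apply: (leq_trans (size_polyMleq _ _)).
apply: (leq_trans (leq_pred _)); apply: leq_add => //.
by apply: leq_trans (leq_bigmax b); apply: leq_trans (leq_bigmax a).
Qed.

(** Rank-nullity telescopes.  The complex extends indefinitely to the left, so the
partial alternating sum equals, up to sign, the rank of the next differential. *)
Lemma euler_exact (k : fieldType) (W : nat -> vectType k)
    (U : forall i, {vspace W i}) (d : forall i, 'Hom(W i.+1, W i)) :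
  (forall i v, v \in U i.+1 -> d i v \in U i) ->
  (forall i w, w \in U i.+2 -> d i (d i.+1 w) = 0) ->
  (forall i v, v \in U i.+1 -> d i v = 0 ->
     exists2 w, w \in U i.+2 & d i.+1 w = v) ->
  U 0%N = 0%VS ->
  forall m, \sum_(i < m.+1) (-1) ^+ i * (\dim (U i))%:Z =
    (-1) ^+ m * (\dim (d m @: U m.+1)%VS)%:Z.
Proof.
move=> dU dd ex U0; elim=> [|m IHm].
  rewrite big_ord1 U0 dimv0; congr (_ * _%:Z); apply/esym/eqP.
  rewrite dimv_eq0 -subv0 -U0; apply/subvP => _ /memv_imgP[v vU ->]; exact: dU.
rewrite big_ord_recr IHm /= -(limg_ker_dim (d m) (U m.+1)).
have -> : (U m.+1 :&: lker (d m))%VS = (d m.+1 @: U m.+2)%VS.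
  apply/vspaceP => v; rewrite memv_cap memv_ker; apply/andP/memv_imgP.
    by case=> vU /eqP /(ex _ _ vU) [w wU <-]; exists w.
  by case=> w wU ->; split; [apply: dU|apply/eqP/dd].
rewrite PoszD exprS; ring.
Qed.

Lemma prod_vspace (k : fieldType) (V : vectType k) (I : finType)
    (T : I -> {vspace V}) : exists U : {vspace {ffun I -> V}},
  (forall f : {ffun I -> V}, f \in U <-> forall l, f l \in T l) /\
  \dim U = (\sum_l \dim (T l))%N.
Proof.
pose io l (a : V) : {ffun I -> V} := [ffun l' => if l' == l then a else 0].
have lio l : linear (io l).
  move=> c a b; apply/ffunP => l'; rewrite !ffunE.
  by case: ifP => // _; rewrite scaler0 addr0.
pose F l : 'Hom(V, {ffun I -> V}) := linfun (lin_of (lio l)).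
have FE l a : F l a = io l a by rewrite lfunE.
exists (\sum_l (F l @: T l))%VS; split=> [f|].
  split=> [/memv_sumP [u hu ->] l|hf].
    rewrite sum_ffunE memv_suml // => l' _; have /memv_imgP [a aT ->] := hu l' isT.
    by rewrite FE ffunE; case: eqP => [->|_] //; apply: mem0v.
  have -> : f = \sum_l F l (f l).
    apply/ffunP => l; rewrite sum_ffunE (bigD1 l) //= FE ffunE eqxx.
    by rewrite big1 ?addr0 // => l' ll'; rewrite FE ffunE eq_sym (negPf ll').
  by apply: memv_sumr => l _; apply: memv_img.
have /directvP -> : directv (\sum_l (F l @: T l)).
  apply/directv_sum_independent => u hu su l _.
  have uE l' : exists a, u l' = io l' a.
    by have /memv_imgP [a _ ->] := hu l' isT; exists a; rewrite FE.
  have [a ua] := uE l; have := congr1 (fun f : {ffun I -> V} => f l) su.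
  rewrite sum_ffunE (bigD1 l) //= big1 ?addr0 => [|l' ll'].
    by rewrite ua !ffunE eqxx => ->; apply/ffunP => l'; rewrite !ffunE if_same.
  by have [a' ->] := uE l'; rewrite ffunE eq_sym (negPf ll').
rewrite /=; apply: eq_bigr => l _; apply: limg_dim_eq; apply/eqP; rewrite -subv0.
apply/subvP => a; rewrite memv_cap memv_ker memv0 => /andP[_ /eqP].
by rewrite FE => /ffunP /(_ l); rewrite !ffunE eqxx => ->.
Qed.

(** * Strands of the linear part *)

Section Strands.

Context (k : fieldType) (Q : quiver) (R : path_alg k Q -> Prop).
Context (quadR : quadratic R) (L : falgType k) (pi : presentation R L).

Local Notation gmod := (gmod pi).
Local Notation e := (idem pi).
Local Notation Lcomp := (Lcomp pi).

Definition peirce_proj (x y : vert Q) (z : int) (a : L) : L := e x * Lcomp z a * e y.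

Lemma peirce_proj_is_linear x y z : linear (peirce_proj x y z).
Proof.
move=> c a b; rewrite /peirce_proj linearP /= mulrDr mulrDl.
by rewrite -scalerAr -scalerAl.
Qed.

HB.instance Definition _ x y z :=
  GRing.isLinear.Build k L L *:%R (peirce_proj x y z) (peirce_proj_is_linear x y z).

(** The space e_x L_z e_y, as the image of a projector. *)
Definition peirce (x y : vert Q) (z : int) : {vspace L} :=
  limg (linfun (peirce_proj x y z)).

Lemma peirceP x y z a :
  a \in peirce x y z <-> [/\ e x * a = a, a * e y = a & Ldeg pi z a].
Proof.
split=> [/memv_imgP [b _ ->]|[xa ay /(LdegP quadR) az]].
  rewrite lfunE /= /peirce_proj; split.
  - by rewrite !mulrA idemM eqxx.
  - by rewrite -!mulrA idemM eqxx.
  - have := LdegM (LdegM (Ldeg_idem pi x) (Ldeg_comp pi z b)) (Ldeg_idem pi y).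
    by rewrite add0r addr0.
apply/memv_imgP; exists a; first exact: memvf.
by rewrite lfunE /= /peirce_proj az xa ay.
Qed.

Lemma peirce_projP x y z a : peirce_proj x y z a \in peirce x y z.
Proof. by apply/memv_imgP; exists a; rewrite ?memvf ?lfunE. Qed.

Lemma peirce_out x y z (l : nat) : (forall z a, l%:Z < z -> Lcomp z a = 0) ->
  (z < 0) || (l%:Z < z) -> peirce x y z = 0%VS.
Proof.
move=> hl hz; apply/eqP; rewrite -subv0; apply/subvP => a /peirceP [_ _].
move/(LdegP quadR) => <-; rewrite memv0.
by case/orP: hz => hz; [rewrite Lcomp_neg|rewrite hl].
Qed.

Lemma dim_peirce0 x y : \dim (peirce x y 0) = (x == y).
Proof.
have E a : a \in peirce x y 0 -> exists c : k, a = if x == y then c *: e x else 0.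
  case/peirceP => xa ay /Ldeg0_span [c ac]; exists (c x).
  have {}ac : a = c x *: e x.
    rewrite -[LHS]xa ac mulr_sumr (bigD1 x) //= big1 ?addr0 => [|w wx].
      by rewrite -scalerAr idemM eqxx.
    by rewrite -scalerAr idemM eq_sym (negPf wx) scaler0.
  by case: ifPn => // xy; rewrite -ay ac -scalerAl idemM (negPf xy) scaler0.
case: (eqVneq x y) E => [<-|xy] E; last first.
  apply/eqP; rewrite dimv_eq0 -subv0; apply/subvP => a aU.
  by have [c ->] := E a aU; apply: mem0v.
have -> : peirce x x 0 = <[e x]>%VS.
  apply/vspaceP => a; apply/idP/vlineP => [aU|[c ->]]; first exact: E.
  apply: memvZ; apply/peirceP; rewrite idemM eqxx; split=> //; exact: Ldeg_idem.
by rewrite dim_vline idem_neq0.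
Qed.

Section Complex.

Variables (C : gseq pi) (M : gmod).
Hypothesis minC : min_resolution C M.

Lemma gdiff_mul0 i : gdiff C i.+1 *m gdiff C i = 0.
Proof.
have [[eps [_ _ _ exS]] _] := minC.
apply/row_matrixP => j; rewrite row_mul row0.
apply/(exS _ _ (@gdiff_row_in _ _ _ _ _ C i.+1 j)).
exists (gvec (gproj_gen quadR pi j)); first exact: gvec_in.
rewrite -seq_diffE -diff_rowE; congr gvec; apply: gproj_lin_gen.
exact: diff_row_gens.
Qed.

Lemma gdiff_pos i j l : ggen j - ggen l <= 0 -> gdiff C i j l = 0.
Proof.
move=> jl; have [_ /(_ i j l) /(LradP quadR) rA] := minC.
have [_ /(LdegP quadR) <-] := @gdiff_map _ _ _ _ _ C i j l.
move: jl; rewrite le_eqVlt => /orP[/eqP ->|jl] //.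
by rewrite Lcomp_neg.
Qed.

(** The entries of the product of two consecutive differentials that lie in degree 2
only involve linear entries, because by minimality all entries have positive
degree; in the other degrees the product of the linear parts has no term. *)
Lemma lin_diff_mul0 i : lin_diff C i.+1 *m lin_diff C i = 0.
Proof.
apply/matrixP => j l; rewrite [RHS]mxE mxE.
have [jl|jl] := eqVneq (ggen j - ggen l) 2; last first.
  rewrite big1 // => m _; rewrite !mxE.
  case: eqP => [jm|]; last by rewrite mul0r.
  case: eqP => [ml|]; last by rewrite mulr0.
  by case/eqP: jl; rewrite -[ggen j](subrK (ggen m)) -addrA jm ml.
have := congr1 (fun A => fun_of_matrix A j l) (gdiff_mul0 i).
rewrite !mxE => E0; rewrite -[RHS]E0; apply: eq_bigr => m _; rewrite !mxE.
case: eqP => [jm|jm].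
  by rewrite ifT //; apply/eqP; move: jl jm; lia.
rewrite mul0r; case: (lerP (ggen j - ggen m) 0) => jm0.
  by rewrite gdiff_pos // mul0r.
by rewrite [X in _ * X]gdiff_pos ?mulr0 //; move: jl jm jm0; lia.
Qed.

Variables (c l : nat).
Hypothesis exC : forall i, (c < i)%N -> ~ nonzero_homology (linear_part C) i.
Hypothesis hl : forall z a, l%:Z < z -> Lcomp z a = 0.

(** The number of summands P_y of the i-th term of the strand j. *)
Definition strand_count (j : int) (i : nat) (y : vert Q) : nat :=
  \sum_(t < grk (gterm C i)) ((ggen t == (i%:Z + j)%R) && (gvtx t == y)).

(** The part of the strand j in internal degree j + D at the vertex x is an exact
complex of vector spaces: its terms with i <= c vanish since D - i > l, and for
i > c the homology of the linear part vanishes by hypothesis. *)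
Lemma strand_euler (x : vert Q) (j : int) (D : nat) : (c + l < D)%N ->
  \sum_(i < D.+1) (-1) ^+ i *
    (\sum_y \dim (peirce x y (D%:Z - i%:Z)%R) * strand_count j i y)%N%:Z = 0.
Proof.
move=> cD.
pose W i : vectType k := {ffun 'I_(grk (gterm C i)) -> L}.
pose T i (t : 'I_(grk (gterm C i))) : {vspace L} :=
  if ggen t == i%:Z + j then peirce x (gvtx t) (D%:Z - i%:Z) else 0%VS.
pose U i : {vspace W i} := sval (cid (prod_vspace (@T i))).
have UP i (f : W i) : f \in U i <-> forall t, f t \in T i t.
  by rewrite /U; case: cid => ? [].
have dimU i : \dim (U i) = (\sum_y \dim (peirce x y (D%:Z - i%:Z)%R) * strand_count j i y)%N.
  have -> : \dim (U i) = (\sum_t \dim (T i t))%N by rewrite /U; case: cid => ? [].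
  under [RHS]eq_bigr => y _ do rewrite /strand_count big_distrr /=.
  rewrite exchange_big /=; apply: eq_bigr => t _.
  rewrite (bigD1 (gvtx t)) //= eqxx andbT big1 ?addn0 => [|y yt].
    by rewrite /T; case: ifP => _; rewrite ?muln1 ?muln0 ?dimv0.
  by rewrite [gvtx t == y]eq_sym (negPf yt) andbF muln0.
pose dd i (f : W i.+1) : W i := [ffun t => \sum_t' f t' * lin_diff C i t' t].
have ldd i : linear (dd i).
  move=> a f g; apply/ffunP => t; rewrite !ffunE scaler_sumr -big_split /=.
  by apply: eq_bigr => t' _; rewrite !ffunE mulrDl -scalerAl.
pose d i : 'Hom(W i.+1, W i) := linfun (lin_of (ldd i)).
have dE i f t : d i f t = \sum_t' f t' * lin_diff C i t' t by rewrite lfunE /= ffunE.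
have U_low i : (i <= c)%N -> U i = 0%VS.
  move=> ic; apply/eqP; rewrite -dimv_eq0 dimU big1 // => y _.
  by rewrite (peirce_out _ _ hl) ?dimv0 ?mul0n //; apply/orP; right; lia.
have U_big i : (D < i)%N -> U i = 0%VS.
  move=> ic; apply/eqP; rewrite -dimv_eq0 dimU big1 // => y _.
  by rewrite (peirce_out _ _ hl) ?dimv0 ?mul0n //; apply/orP; left; lia.
have inU i (f : W i) : f \in U i -> forall t,
    [/\ e x * f t = f t, f t * e (gvtx t) = f t, Ldeg pi (D%:Z - i%:Z) (f t)
      & ggen t != i%:Z + j -> f t = 0].
  move=> fU t; move/UP: fU => /(_ t); rewrite /T; case: ifP => _.
    by case/peirceP.
  by rewrite memv0 => /eqP ->; rewrite mulr0 mul0r; split=> //; apply: Ldeg0.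
have dU i v : v \in U i.+1 -> d i v \in U i.
  move=> vU; apply/UP => t; rewrite dE /T.
  apply: rpred_sum => t' _; have [xv vy vd v0] := inU _ _ vU t'.
  rewrite mxE; case: ifP => [/eqP tt|_]; last by rewrite mulr0 mem0v.
  have [At dt] := @gdiff_map _ _ _ _ _ C i t' t.
  have [g'|g'] := eqVneq (ggen t') (i.+1%:Z + j); last by rewrite v0 // mul0r mem0v.
  rewrite ifT; last by apply/eqP; move: tt g'; lia.
  apply/peirceP; split.
  - by rewrite mulrA xv.
  - by rewrite -mulrA -At -!mulrA idemM eqxx.
  - rewrite (_ : D%:Z - i%:Z = (D%:Z - i.+1%:Z) + (ggen t' - ggen t)); last by lia.
    exact: LdegM.
have ddz i w : w \in U i.+2 -> d i (d i.+1 w) = 0.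
  move=> _; apply/ffunP => t; rewrite dE ffunE.
  have := congr1 (fun A => ((\row_s w s) *m A) 0 t) (lin_diff_mul0 i).
  rewrite mulmxA mulmx0 mxE [RHS]mxE => E0; rewrite -[RHS]E0; apply: eq_bigr => t' _.
  congr (_ * _); rewrite dE mxE; apply: eq_bigr => s _.
  by rewrite [(\row_s0 w s0) _ _]mxE.
have ex i v : v \in U i.+1 -> d i v = 0 -> exists2 w, w \in U i.+2 & d i.+1 w = v.
  move=> vU dv; case: (leqP i.+1 c) => ic.
    by exists 0; rewrite ?mem0v // linear0; move: vU; rewrite U_low // memv0 => /eqP.
  have := exC ic; pose v' : 'rV[L]_(grk (gterm C i.+1)) := \row_t v t.
  have v'in : in_gproj pi v' by move=> t; rewrite mxE; have [] := inU _ _ vU t.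
  have v'0 : v' *m lin_diff C i = 0.
    apply/rowP => t; rewrite [RHS]mxE; move/ffunP: dv => /(_ t).
    by rewrite dE ffunE mxE => {2}<-; apply: eq_bigr => t' _; rewrite mxE.
  move=> nh; have [w win wv] : coboundary (C := linear_part C) (i := i.+1) v'.
    by apply: contrapT => nc; apply: nh; exists v'.
  rewrite /= in w win wv.
  (* A preimage of v in the linear part need not lie in the strand or be
     homogeneous: w' is its component there. *)
  pose w' : W i.+2 := [ffun t => if ggen t == i.+2%:Z + j
     then peirce_proj x (gvtx t) (D%:Z - i.+2%:Z) (w 0 t) else 0].
  exists w'.
    apply/UP => t; rewrite ffunE /T; case: ifP => _; first exact: peirce_projP.
    exact: mem0v.
  have lin0 s t : ggen s - ggen t != 1 -> lin_diff C i.+1 s t = 0.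
    by move=> h; rewrite mxE (negPf h).
  apply/ffunP => t; rewrite dE; have [xv vy vd v0] := inU _ _ vU t.
  have [gt|gt] := eqVneq (ggen t) (i.+1%:Z + j); last first.
    rewrite v0 // big1 // => s _; rewrite ffunE; case: eqP => gs; last by rewrite mul0r.
    by rewrite lin0 ?mulr0 //; apply: contraNneq gt; move: gs; lia.
  have /(congr1 (fun u : 'rV__ => e x * Lcomp (D%:Z - i.+1%:Z) (u 0 t))) := wv.
  rewrite [in RHS]mxE (Lcomp_deg quadR _ vd) eqxx xv => <-.
  rewrite mxE linear_sum mulr_sumr /=; apply: eq_bigr => s _; rewrite ffunE.
  have [st|st] := eqVneq (ggen s - ggen t) 1; last by rewrite lin0 ?mulr0 ?linear0 ?mulr0.
  rewrite ifT; last by apply/eqP; move: gt st; lia.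
  have [As ds] := @lin_diff_map _ _ _ _ _ C i.+1 s t.
  rewrite (Lcomp_mulr quadR _ _ ds) st /peirce_proj -!mulrA.
  rewrite (_ : D%:Z - i.+1%:Z - 1 = D%:Z - i.+2%:Z); last by lia.
  congr (_ * (_ * _)); by rewrite -As !mulrA idemM eqxx.
have := euler_exact dU ddz ex (U_low 0%N isT) D.
rewrite U_big // limg0 dimv0 mulr0 => E0; rewrite -[RHS]E0.
by apply: eq_bigr => i _; rewrite dimU.
Qed.

End Complex.

End Strands.

(** * The bound on the length *)

Section LengthBound.

Context (k : fieldType) (Q : quiver) (R : path_alg k Q -> Prop).
Context (quadR : quadratic R) (L : falgType k) (pi : presentation R L).

(** The graded Cartan matrix, truncated at t^l. *)
Definition hilbert_mx (l : nat) : 'M[{poly int}]_#|vert Q| :=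
  \matrix_(a, b) \poly_(m < l.+1) (\dim (peirce pi (enum_val a) (enum_val b) m%:Z))%:Z.

(** At t = 0 the matrix is the identity, because e_x L_0 e_y is spanned by the
idempotent e_x if x = y and is zero otherwise. *)
Lemma det_hilbert_mx l : \det (hilbert_mx l) != 0.
Proof.
apply/eqP => /(congr1 (horner_eval (0 : int))); rewrite rmorph0 -det_map_mx.
rewrite (_ : map_mx _ _ = 1%:M) ?det1; first by move/eqP; rewrite oner_eq0.
apply/matrixP => a b; rewrite !mxE /= /horner_eval horner_coef0 coef_poly /=.
rewrite dim_peirce0 // (inj_eq enum_val_inj); by case: eqP.
Qed.

(** The bound depends on L and c only.  A summand of the i-th term belongs to some
strand, where it makes the coefficient of t^i in q nonzero. *)
Lemma length_bound (c : nat) : exists B : nat, forall (C : gseq pi) (M : gmod pi) (p : nat),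
  min_resolution C M ->
  (forall i, (c < i)%N -> ~ nonzero_homology (linear_part C) i) ->
  (forall i, (p < i)%N -> grk (gterm C i) = 0%N) ->
  forall i, (B < i)%N -> grk (gterm C i) = 0%N.
Proof.
have [l hl] := Lcomp_bounded quadR pi.
have [B hB] := bounded_solutions (c + l).+1 (det_hilbert_mx l).
exists B => C M p minC exC C0 i Bi.
apply/eqP; rewrite -leqn0 leqNgt; apply/negP => ri.
pose t0 := Ordinal ri; pose j := ggen t0 - i%:Z.
have count0 i' y : (p < i')%N -> strand_count C j i' y = 0%N.
  move=> /C0 r0; rewrite /strand_count big1 // => t _.
  by have := ltn_ord t; rewrite {2}r0.
pose q : 'cV[{poly int}]_#|vert Q| :=
  \col_b \poly_(i < p.+1) ((-1) ^+ i * (strand_count C j i (enum_val b))%:Z).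
have qE b m : (q b 0)`_m = (-1) ^+ m * (strand_count C j m (enum_val b))%:Z.
  by rewrite mxE coef_poly ltnS; case: leqP => // /count0 ->; rewrite mulr0.
have hE a b m : (hilbert_mx l a b)`_m =
    (\dim (peirce pi (enum_val a) (enum_val b) m%:Z))%:Z.
  rewrite mxE coef_poly ltnS; case: leqP => // lm.
  by rewrite (peirce_out quadR _ _ hl) ?dimv0 // ltz_nat lm orbT.
have /hB sq : forall a, (size ((hilbert_mx l *m q) a 0%R) <= (c + l).+1)%N.
  move=> a; apply/leq_sizeP => D cD; rewrite mxE coef_sum.
  rewrite -[RHS](strand_euler quadR minC exC hl (enum_val a) j cD).
  under eq_bigr => b _ do rewrite coefMr.
  rewrite exchange_big /=; apply: eq_bigr => m _.
  under eq_bigr => b _ do rewrite hE qE mulrCA -PoszM.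
  rewrite -mulr_sumr -subzn -1?ltnS //; congr (_ * _).
  rewrite [in RHS](reindex _ (onW_bij _ (@enum_val_bij (vert Q)))) /=.
  by rewrite (big_morph Posz PoszD (erefl (0%N : int))).
have /leq_sizeP /(_ i (ltnW Bi)) := sq (enum_rank (gvtx t0)).
rewrite qE enum_rankK => /eqP; rewrite mulf_eq0 signr_eq0 /=.
by rewrite /strand_count (bigD1 t0) //= /j addrC subrK !eqxx.
Qed.

End LengthBound.

Theorem corollaryA (k : fieldType) (Q : quiver) (R : path_alg k Q -> Prop)
  (quadR : quadratic R) (L : falgType k) (pi : presentation R L)
  (akL : absolutely_koszul pi) (finL : gl_ld pi <> Infty) :
  grfin_dim pi <> Infty.
Proof.
move/esup_finP: finL => [c hc].
have ld_le M i : nonzero_lin_homology (pi := pi) M i -> (i <= c)%N.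
  move=> Mi; have := hc _ (ex_intro _ M erefl).
  case Ed: (ld M) => [n|] // nc; apply: leq_trans nc.
  have /esup_finP [m hm] : ld M <> Infty by rewrite Ed.
  move: Ed; rewrite /ld /esup; case: pselect => // h [<-].
  case: ex_minnP => m' /asboolP hm' _.
  exact: (hm' (Fin i) (ex_intro _ i (conj Mi erefl))).
have [B hB] := length_bound quadR pi c.
apply/esup_finP; exists B => _ [M [pdM ->]].
have [n resM] : exists n, has_proj_res M n.
  by move: pdM; rewrite /pd /einf; case: pselect => // -[n /asboolP h] _; exists n.
apply/einf_leP; exists B => //.
have minC := min_resP quadR M.
apply: (has_proj_res_of_gseq quadR minC.1).
apply: (hB _ _ n minC) => [i ci hi|].
  by have := ld_le M i (ex_intro _ _ (conj minC hi)); rewrite leqNgt ci.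
exact: (min_resolution_length quadR minC resM).
Qed.
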